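(* Let $N\ge2$, let $(V,E)=T_N$ be the homogeneous tree of degree $N$, fix a vertex $o\in V$, and let $(p,q)\in\mathbb{R}^2$. Consider the inequality $$\Delta u+u^p|\nabla u|^q\le 0\quad\text{on } V. \qquad ( * )$$ (I) Assume $p\ge0$ and $1-p<q<2$. For every $\epsilon>0$ (arbitrarily small) there exists a weight $\mu$ on $T_N$ satisfying $\mu(B(o,n))\asymp n^{\frac{2p+q}{p+q-1}}(\ln n)^{\frac1{p+q-1}+\epsilon}$ for $n\ge2$, such that $( * )$ admits a nontrivial positive solution on $(V,\mu)$. (II) Assume $q\ge2$ ($p\in\mathbb{R}$ arbitrary). For every $\epsilon>0$ (arbitrarily small) there exists a weight $\mu$ on $T_N$ satisfying $\mu(B(o,n))\asymp n^{2}(\ln n)^{1+\epsilon}$ for $n\ge2$, such that $( * )$ admits a nontrivial positive solution on $(V,\mu)$. (III) Assume $p<0$ and $1<q<2$. For every $\epsilon>0$ (arbitrarily small) there exists a weight $\mu$ on $T_N$ satisfying $\mu(B(o,n))\asymp n^{\frac{q}{q-1}}(\ln n)^{\frac1{q-1}+\epsilon}$ for $n\ge2$, such that $( * )$ admits a nontrivial positive solution on $(V,\mu)$. (IV) Assume $p<0$ and $q=1$. Given any $\lambda>0$, there exists a weight $\mu$ on $T_N$ satisfying $\mu(B(o,n))\asymp e^{\lambda n}$ for $n\ge2$, such that $( * )$ admits a nontrivial positive solution on $(V,\mu)$. (V) Assume that either ($p+q=1$, $p\ge0$, $q>0$) or ($p+q=1$, $q<0$). Then there exist a weight $\mu$ on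 $T_N$ and a constant $\lambda>0$ satisfying $\mu(B(o,n))\asymp e^{\lambda n}$ for $n\ge2$, such that $( * )$ admits a nontrivial positive solution on $(V,\mu)$.
   Context: A tree is a connected graph in which any two distinct vertices are joined by only one path; the homogeneous tree $T_N$ is the (infinite) tree all of whose vertices have degree $N$. $x\sim y$ means that $x,y$ are joined by an edge. A weight $\mu$ on a graph $(V,E)$ assigns $\mu_{xy}=\mu_{yx}>0$ to each pair $x\sim y$, with $\mu_{xy}=0$ otherwise; the vertex measure is $\mu(x)=\sum_{y\sim x}\mu_{xy}$, and $\mu(A)=\sum_{x\in A}\mu(x)$ for $A\subset V$. For $u:V\to\mathbb{R}$, $$\Delta u(x)=\sum_{y\sim x}\frac{\mu_{xy}}{\mu(x)}(u(y)-u(x)),\qquad |\nabla u(x)|=\sqrt{\sum_{y\sim x}\frac{\mu_{xy}}{2\mu(x)}(u(y)-u(x))^2}.$$ $d$ is the graph distance (minimal number of edges in a path), and $B(o,n)=\{x\in V: d(o,x)\le n\}$ for integers $n\ge1$. $A\asymp B$ means that both $A/B$ and $B/A$ are bounded above by positive constants (independent of $n$). A nontrivial positive solution of the inequality is a non-constant function $u:V\to(0,\infty)$ satisfying it at every vertex. Conventions: $|\nabla u(x)|^0=1$; if $q<0$, then $|\nabla u(x)|^q=+\infty$ when $|\nabla u(x)|=0$, so the inequality at $x$ requires $|\nabla u(x)|>0$. *)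

(* Defs.v *)
From mathcomp Require Import all_boot all_order all_algebra.
From mathcomp Require Import all_classical all_reals all_analysis.
Set Implicit Arguments.
Unset Strict Implicit.
Unset Printing Implicit Defensive.
Import Order.TTheory GRing.Theory Num.Theory.
Local Open Scope classical_set_scope.
Local Open Scope ring_scope.

(** A path from [x] to [y] is [x :: s]; it has no repeated vertex and
    [size s] edges. *)
Definition is_path (V : choiceType) (E : rel V) (x y : V) (s : seq V) : Prop :=
  [/\ path E x s, uniq (x :: s) & last x s = y].

Definition neighbors (V : choiceType) (E : rel V) (x : V) : set V :=
  [set y | E x y].

Definition is_tree (V : choiceType) (E : rel V) : Prop :=
  [/\ symmetric E, irreflexive E,
      forall x y, exists s, is_path E x y s
    & forall x y s t, x <> y -> is_path E x y s -> is_path E x y t -> s = t].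

(** [T_N] is unique up to isomorphism for a nonempty vertex set. *)
Definition homogeneous_tree (N : nat) (V : choiceType) (E : rel V) : Prop :=
  is_tree E /\ forall x, (neighbors E x #= `I_N)%card.

(** The default value 0 is used only when no path joins [x] to [y]. *)
Definition gdist (V : choiceType) (E : rel V) (x y : V) : nat :=
  xget 0%N [set n : nat |
    (exists2 s, is_path E x y s & size s = n) /\
    (forall s, is_path E x y s -> (n <= size s)%N)].

Definition gball (V : choiceType) (E : rel V) (o : V) (n : nat) : set V :=
  [set x | (gdist E o x <= n)%N].

Definition is_weight (R : realType) (V : choiceType) (E : rel V)
    (mu : V -> V -> R) : Prop :=
  [/\ forall x y, mu x y = mu y x,
      forall x y, E x y -> 0 < mu x y
    & forall x y, ~~ E x y -> mu x y = 0].

(** The sums over sets below are finitely supported sums; neighborhoods and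
    balls are finite in a locally finite graph. *)
Definition vmeasure (R : realType) (V : choiceType) (E : rel V)
    (mu : V -> V -> R) (x : V) : R :=
  \sum_(y \in neighbors E x) mu x y.

Definition smeasure (R : realType) (V : choiceType) (E : rel V)
    (mu : V -> V -> R) (A : set V) : R :=
  \sum_(x \in A) vmeasure E mu x.

Definition laplacian (R : realType) (V : choiceType) (E : rel V)
    (mu : V -> V -> R) (u : V -> R) (x : V) : R :=
  \sum_(y \in neighbors E x) mu x y / vmeasure E mu x * (u y - u x).

Definition gradnorm (R : realType) (V : choiceType) (E : rel V)
    (mu : V -> V -> R) (u : V -> R) (x : V) : R :=
  Num.sqrt (\sum_(y \in neighbors E x)
    mu x y / (2 * vmeasure E mu x) * (u y - u x) ^+ 2).

(** [t ^ q] for [t >= 0], with [0 ^ q = +oo] for [q < 0] (where [powR] would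
    give 0) and [0 ^ 0 = 1]. *)
Definition gradpow (R : realType) (t q : R) : \bar R :=
  if (t == 0) && (q < 0) then +oo%E else (t `^ q)%:E.

Definition nontrivial_positive_solution (R : realType) (V : choiceType)
    (E : rel V) (mu : V -> V -> R) (p q : R) (u : V -> R) : Prop :=
  [/\ forall x, 0 < u x,
      ~ (exists c, forall x, u x = c)
    & forall x, ((laplacian E mu u x)%:E +
                 (u x `^ p)%:E * gradpow (gradnorm E mu u x) q <= 0)%E].

Definition asymp (R : realType) (f g : nat -> R) : Prop :=
  exists C1 C2 : R, [/\ 0 < C1, 0 < C2 &
    forall n, (2 <= n)%N -> f n / g n <= C1 /\ g n / f n <= C2].

(* Main.v *)
Require Import Defs.
From mathcomp Require Import all_boot all_order all_algebra.
From mathcomp Require Import all_classical all_reals all_analysis.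
From mathcomp Require Import finmap zify ring lra.
Import Order.TTheory GRing.Theory Num.Theory.
Local Open Scope ring_scope.

(** Parts I-IV are solved by radial functions. Give the edges between the
    spheres of radius [n] and [n+1] about [o] the total weight [w n], shared
    equally, and let [u x = f (d (o, x))] with [f] decreasing. The tree then
    behaves like a half-line: with the decrement [g n = f n - f n.+1] and the
    flux [w n * g n], the inequality at distance [n+1] says that the flux
    increases by at least [(w n + w n.+1) * u^p * |grad u|^q]
    ([radial_solution]), and the ball of radius [n] has measure comparable to
    [w 0 + ... + w n] ([radial_ball]).

    A profile is called [admissible] when this holds up to a constant factor,
    with [f^r] in place of [u^p]. The constant is then absorbed by passing to
    [A + delta * f] ([admissible_scaling]), in three ways:
    - [A = 0], [r = p] and [delta] small: the right-hand side is homogeneous of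
      degree [p + q > 1] (part I);
    - [A = 1], [r = 0] and [delta] small: [u^p] is bounded, and the right-hand
      side has degree [q > 1] in [delta] (parts II and III);
    - [delta = 1] and [A] large: if [p < 0] then [u^p] is small (part IV).

    The profiles are monomials in [n] and [ln n]. Write [s = r + q - 1]. Below
    the critical exponent [q = 2], take [f = n^(-a) (ln n)^(-b)] with
    [a = (2 - q) / s] and [b = 1 / s], and the flux [(ln n)^eps]
    ([subcritical_profile]). For [q >= 2], take [f = (ln n)^(-eps)] and a
    bounded flux whose increments are exactly the decrements of [f]
    ([critical_profile]). In part IV both [w] and [f] are exponential.

    In part V the inequality is homogeneous of degree one and scaling gives
    nothing. For [q < 0] no radial function works: at the center [o] the
    inequality would force [u o - u y > u o]. Instead a ray from [o] and its
    horofunction [height] are used: every vertex has one neighbor at height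
    one less and [N - 1] neighbors at height one more. With weights
    exponential in the height, all vertices look alike for [u = T^(-height)],
    and the whole problem is one scalar inequality between [T] and the growth
    rate [S] of the balls ([horo_solution]), which holds for [S = T^3] and [T]
    large if [q > 0], and for [T = t^2], [S = t^3] and [t] large if [q < 0]. *)

Set Implicit Arguments.
Unset Strict Implicit.
Unset Printing Implicit Defensive.

(** * Paths, children and spheres in a rooted tree *)

Section TreeCombinatorics.
Variables (V : choiceType) (E : rel V) (o : V).

Definition tpath (x : V) : seq V := xget [::] [set s | is_path E o x s]%classic.

Definition depth (x : V) : nat := size (tpath x).

(** Phrased with paths from the root, so that two parents of the same vertex
    have the same path, hence are equal. *)
Definition child (x y : V) : bool := tpath y == rcons (tpath x) y.

Definition nbrs (x : V) : seq V := fset_set (neighbors E x).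

Definition children (x : V) : seq V := [seq y <- nbrs x | child x y].

Definition sphere (n : nat) : seq V :=
  iter n (fun s => flatten [seq children x | x <- s]) [:: o].

Hypothesis hT : is_tree E.

Lemma is_path_unique x s t : is_path E o x s -> is_path E o x t -> s = t.
Proof.
case: hT => _ _ _ uniqP ps pt.
have [xo|/eqP/nesym xo] := eqVneq x o; last exact: (uniqP _ _ _ _ xo).
(* the uniqueness axiom of a tree is about distinct ends: a path without
   repetition from [o] to itself has no edge *)
have nil r : is_path E o x r -> r = [::].
  rewrite xo => -[_ + lr]; case/lastP: r lr => // r y; rewrite last_rcons => ->.
  by rewrite /= mem_rcons inE eqxx.
by rewrite (nil _ ps) (nil _ pt).
Qed.

Lemma tpathP x : is_path E o x (tpath x).
Proof.
apply: (@xgetPex _ [::] [set s | is_path E o x s]%classic).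
by case: hT => _ _ conn _; exact: conn.
Qed.

Lemma tpath_unique x s : is_path E o x s -> tpath x = s.
Proof. exact: is_path_unique (tpathP x). Qed.

Lemma last_tpath x : last o (tpath x) = x.
Proof. by case: (tpathP x). Qed.

Lemma tpath_inj : injective tpath.
Proof. by move=> x y e; rewrite -(last_tpath x) e last_tpath. Qed.

Lemma tpath_root : tpath o = [::].
Proof. by apply: tpath_unique; split. Qed.

Lemma depth_root : depth o = 0%N.
Proof. by rewrite /depth tpath_root. Qed.

Lemma depth_eq0 x : depth x = 0%N -> x = o.
Proof. by move/size0nil => e; rewrite -(last_tpath x) e. Qed.

Lemma gdistE x : gdist E o x = depth x.
Proof.
rewrite /gdist; apply: xget_unique => /=.
- split; first by exists (tpath x) => //; exact: tpathP.
  by move=> s /tpath_unique <-.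
- by move=> n [[s /tpath_unique <- <-]].
Qed.

Lemma tree_sym x y : E x y = E y x.
Proof. by case: hT => /(_ x y). Qed.

(** Appending [y] to the path of [x] gives a path when [y] is new; otherwise
    cutting the path of [x] at [y] gives the path of [y]. *)
Lemma edge_child x y : E x y -> child x y || child y x.
Proof.
move=> Exy; case: (tpathP x) => px ux lx.
have [|yN] := boolP (y \in o :: tpath x); last first.
  apply/orP; left; apply/eqP/tpath_unique; split.
  - by rewrite rcons_path px lx Exy.
  - by rewrite -rcons_cons rcons_uniq yN ux.
  - by rewrite last_rcons.
move=> yin; case/splitPl: yin px ux lx => p1 p2 l1.
rewrite cat_path l1 -cat_cons cat_uniq last_cat l1 => /andP[pp1 pp2] /and3P[u1 h u2] lx.
apply/orP; right; apply/eqP/tpath_unique.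
have xN : x \notin o :: p1.
  case/lastP: p2 => [|p2 z] in lx h pp2 u2 *.
    by move: lx => /= yx; case: hT => _ irr _ _; rewrite yx irr in Exy.
  rewrite last_rcons in lx; subst z.
  by apply: contra h => xin; apply/hasP; exists x => //; rewrite mem_rcons inE eqxx.
have -> : tpath y = p1 by apply: tpath_unique; split.
split.
- by rewrite rcons_path pp1 l1 tree_sym.
- by rewrite -rcons_cons rcons_uniq xN.
- by rewrite last_rcons.
Qed.

Lemma child_edge x y : child x y -> E x y.
Proof.
move=> /eqP e; case: (tpathP y); rewrite e rcons_path => /andP[_].
by rewrite last_tpath.
Qed.

Lemma depth_child x y : child x y -> depth y = (depth x).+1.
Proof. by rewrite /depth => /eqP ->; rewrite size_rcons. Qed.

Lemma parent_unique x y z : child x z -> child y z -> x = y.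
Proof. by move=> /eqP e /eqP; rewrite e => /rcons_inj [/tpath_inj]. Qed.

Lemma parent_exists y : y <> o -> exists x, child x y.
Proof.
move=> yo; case: (tpathP y); rewrite /child.
case/lastP: (tpath y) => [|s z]; first by move=> _ _ /esym.
rewrite rcons_path last_rcons -rcons_cons rcons_uniq => /andP[ps _] /andP[_ us] <-.
exists (last o s); have -> : tpath (last o s) = s by apply: tpath_unique.
by rewrite eqxx.
Qed.

Lemma child_asym x y : child x y -> ~~ child y x.
Proof. by move=> /depth_child d; apply/negP => /depth_child; lia. Qed.

Variable N : nat.
Hypothesis hN : forall x, (neighbors E x #= `I_N)%card.

Lemma neighbors_finite x : finite_set (neighbors E x).
Proof. by apply/finite_setP; exists N. Qed.

Lemma mem_nbrs x y : (y \in nbrs x) = E x y.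
Proof.
rewrite /nbrs in_fset_set; last exact: neighbors_finite.
by rewrite /neighbors mem_setE.
Qed.

Lemma nbrs_uniq x : uniq (nbrs x).
Proof. exact: fset_uniq. Qed.

Lemma size_nbrs x : size (nbrs x) = N.
Proof. exact: card_fset_set. Qed.

Lemma sum_neighbors (R : realType) (x : V) (F : V -> R) :
  \sum_(y \in neighbors E x) F y = \sum_(y <- nbrs x) F y.
Proof. by rewrite fsbig_finite//; exact: neighbors_finite. Qed.

(** Both constructions below are constant on the neighbors of a vertex, with
    one exception [a]: the parent, or the next vertex of the ray. *)
Lemma sum_neighbors1 (R : realType) (x a : V) (F : V -> R) (c : R) : E x a ->
  (forall y, E x y -> y != a -> F y = c) ->
  \sum_(y \in neighbors E x) F y = F a + N.-1%:R * c.
Proof.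
move=> xa Fc; rewrite sum_neighbors.
have ain : a \in nbrs x by rewrite mem_nbrs.
rewrite (perm_big _ (perm_to_rem ain)) big_cons.
have -> : \sum_(y <- rem a (nbrs x)) F y = \sum_(y <- rem a (nbrs x)) c.
  apply: eq_big_seq => y; rewrite mem_rem_uniq ?nbrs_uniq// !inE mem_nbrs.
  by move=> /andP[ya xy]; exact: Fc.
by rewrite big_const_seq count_predT size_rem ?mem_nbrs// size_nbrs iter_addr_0 mulr_natl.
Qed.

Lemma mem_children x y : (y \in children x) = child x y.
Proof.
rewrite mem_filter mem_nbrs; case c : (child x y) => //=.
exact: child_edge.
Qed.

Lemma children_uniq x : uniq (children x).
Proof. exact/filter_uniq/nbrs_uniq. Qed.

Lemma size_children x : size (children x) = if x == o then N else N.-1.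
Proof.
have [->|/eqP xo] := eqVneq x o.
  rewrite -(size_nbrs o) /children; congr size; apply/all_filterP/allP => y.
  rewrite mem_nbrs => /edge_child /orP[//|/depth_child].
  by rewrite depth_root.
have [z zx] := parent_exists xo.
rewrite -(size_nbrs x) -(@size_rem _ z); last first.
  by rewrite mem_nbrs tree_sym child_edge.
apply/perm_size/uniq_perm.
- exact: children_uniq.
- exact/rem_uniq/nbrs_uniq.
move=> y; rewrite mem_children mem_rem_uniq ?nbrs_uniq// !inE mem_nbrs.
apply/idP/andP => [c|[yz /edge_child /orP[//|yx]]].
  split; last exact: child_edge.
  by apply: contraTneq c => ->; exact: child_asym.
by rewrite (parent_unique zx yx) eqxx in yz.
Qed.

Lemma mem_sphere n x : (x \in sphere n) = (depth x == n).
Proof.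
elim: n x => [|n IH] x.
  rewrite inE; apply/eqP/eqP => [->|/depth_eq0//]; exact: depth_root.
apply/flatten_mapP/eqP => [[y]|dx].
  by rewrite IH mem_children => /eqP <- /depth_child.
have [|y yx] := @parent_exists x; first by move=> xo; rewrite xo depth_root in dx.
exists y; last by rewrite mem_children.
by rewrite IH; move: (depth_child yx); rewrite dx => -[->].
Qed.

Lemma sphere_uniq n : uniq (sphere n).
Proof.
elim: n => [//|n]; rewrite [sphere n.+1]/=.
elim: (sphere n) => [//|x s IH] /= /andP[xs us].
rewrite cat_uniq children_uniq IH// andbT /=; apply/hasPn => y /flatten_mapP[z zs].
rewrite mem_children => zy; apply: contra xs; rewrite mem_children => xy.
by rewrite (parent_unique xy zy).
Qed.

Lemma sum_sphereS (R : realType) n (F : V -> R) :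
  \sum_(y <- sphere n.+1) F y = \sum_(x <- sphere n) \sum_(y <- children x) F y.
Proof. by rewrite [sphere n.+1]/= big_flatten big_map. Qed.

Lemma sum_ball (R : realType) n (F : V -> R) :
  \sum_(x \in gball E o n) F x = \sum_(0 <= k < n.+1) \sum_(x <- sphere k) F x.
Proof.
have u : uniq (flatten [seq sphere k | k <- iota 0 n.+1]).
  elim: (iota 0 n.+1) (iota_uniq 0 n.+1) => [//|k s IH] /= /andP[ks us].
  rewrite cat_uniq sphere_uniq IH// andbT /=.
  apply/hasPn => y /flatten_mapP[j js]; rewrite mem_sphere => /eqP yj.
  by apply: contra ks; rewrite mem_sphere => /eqP <-; rewrite yj.
have mem x : (x \in flatten [seq sphere k | k <- iota 0 n.+1]) = (depth x <= n)%N.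
  apply/flatten_mapP/idP => [[k]|dx].
    by rewrite mem_iota mem_sphere add0n ltnS => /andP[_ kn] /eqP ->.
  by exists (depth x); rewrite ?mem_sphere// mem_iota.
have -> : gball E o n = [set` flatten [seq sphere k | k <- iota 0 n.+1]]%classic.
  by apply/seteqP; split => x; rewrite /gball /mkset gdistE mem.
by rewrite -fsbig_seq// big_flatten big_map /index_iota subn0.
Qed.

End TreeCombinatorics.

(** * Radial weights and radial solutions *)

Section SolutionsOnTheTree.
Variables (R : realType) (N : nat) (V : choiceType) (E : rel V) (o : V).
Hypothesis N2 : (2 <= N)%N.
Hypothesis hE : homogeneous_tree N E.

Let hT : is_tree E := hE.1.
Let hN : forall x, (neighbors E x #= `I_N)%card := hE.2.

Lemma natN1_gt0 : 0 < N.-1%:R :> R.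
Proof. by rewrite ltr0n; lia. Qed.

Lemma child_exists x : exists y, child E o x y.
Proof.
case c : (children E o x) (size_children o hT hN x) => [|y s] /=.
  by case: ifP => _; lia.
move=> _; exists y; rewrite -(mem_children o hT hN) c; exact: mem_head.
Qed.

Lemma vmeasureE (mu : V -> V -> R) x a b : E x a ->
  (forall y, E x y -> y != a -> mu x y = b) ->
  vmeasure E mu x = mu x a + N.-1%:R * b.
Proof. exact: sum_neighbors1. Qed.

(** As [u a] differs from [u x], the gradient is nonzero at [x], so the infinite
    value of a negative power never occurs. *)
Lemma vertex_inequality (mu : V -> V -> R) (u : V -> R) (p q : R) x a b ub :
  E x a -> 0 < mu x a -> 0 < b ->
  (forall y, E x y -> y != a -> mu x y = b /\ u y = ub) ->
  u a != u x ->
  u x `^ p *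
    Num.sqrt ((mu x a * (u a - u x) ^+ 2 + N.-1%:R * b * (ub - u x) ^+ 2)
              / (2 * (mu x a + N.-1%:R * b))) `^ q
  <= (mu x a * (u x - u a) + N.-1%:R * b * (u x - ub)) / (mu x a + N.-1%:R * b) ->
  ((laplacian E mu u x)%:E + (u x `^ p)%:E * gradpow (gradnorm E mu u x) q <= 0)%E.
Proof.
move=> xa m0 b0 H ne; have n0 := natN1_gt0.
have vm : vmeasure E mu x = mu x a + N.-1%:R * b.
  by apply: vmeasureE => // y xy /(H _ xy)[].
have vm0 : 0 < mu x a + N.-1%:R * b by rewrite addr_gt0// mulr_gt0.
have -> : laplacian E mu u x =
    - ((mu x a * (u x - u a) + N.-1%:R * b * (u x - ub)) / (mu x a + N.-1%:R * b)).
  rewrite /laplacian (sum_neighbors1 hN (c := b / vmeasure E mu x * (ub - u x)) xa).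
    by rewrite vm; field; rewrite gt_eqF.
  by move=> y xy /(H _ xy)[-> ->].
have -> : gradnorm E mu u x =
    Num.sqrt ((mu x a * (u a - u x) ^+ 2 + N.-1%:R * b * (ub - u x) ^+ 2)
              / (2 * (mu x a + N.-1%:R * b))).
  rewrite /gradnorm
    (sum_neighbors1 hN (c := b / (2 * vmeasure E mu x) * (ub - u x) ^+ 2) xa).
    by rewrite vm; congr Num.sqrt; field; rewrite gt_eqF.
  by move=> y xy /(H _ xy)[-> ->].
set G := Num.sqrt _ => le; have G0 : 0 < G.
  rewrite sqrtr_gt0 divr_gt0 ?mulr_gt0// ltr_pwDl//.
    by rewrite mulr_gt0// lt_def sqr_ge0 expf_neq0// subr_eq0.
  by rewrite mulr_ge0 ?sqr_ge0// mulr_ge0 // ltW.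
by rewrite /gradpow gt_eqF//= -EFinM -EFinD lee_fin addrC subr_le0.
Qed.

(** There are as many edges between the spheres [m] and [m+1] as vertices in
    the sphere [m+1], so these edges have total weight [w m]. *)
Definition radial_weight (w : nat -> R) (x y : V) : R :=
  if E x y then
    let m := minn (depth E o x) (depth E o y) in
    w m / (size (sphere E o m.+1))%:R
  else 0.

Lemma size_sphere1 : size (sphere E o 1) = N.
Proof. by rewrite /sphere/= cats0 (size_children o hT hN) eqxx. Qed.

Lemma size_sphereSS k : size (sphere E o k.+2) = (N.-1 * size (sphere E o k.+1))%N.
Proof.
rewrite [sphere E o k.+2]/= size_flatten /shape -map_comp sumnE big_map.
rewrite big_seq (eq_bigr (fun=> N.-1)); last first.
  move=> x; rewrite -[flatten _]/(sphere E o k.+1) (mem_sphere o hT hN) => /eqP dx.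
  rewrite /= (size_children o hT hN); case: eqP dx => // ->.
  by rewrite (depth_root o hT).
by rewrite -big_seq big_const_seq count_predT iter_addn_0 mulnC.
Qed.

Lemma size_sphere_gt0 k : 0 < (size (sphere E o k.+1))%:R :> R.
Proof.
rewrite ltr0n; elim: k => [|k IH]; first by rewrite size_sphere1; lia.
by rewrite size_sphereSS muln_gt0 IH; lia.
Qed.

Lemma radial_weight_child (w : nat -> R) x y : child E o x y ->
  radial_weight w x y = w (depth E o x) / (size (sphere E o (depth E o x).+1))%:R.
Proof.
move=> c; rewrite /radial_weight (child_edge hT c) (depth_child c).
by rewrite (minn_idPl _).
Qed.

Lemma radial_weight_sym (w : nat -> R) x y : radial_weight w x y = radial_weight w y x.
Proof. by rewrite /radial_weight (tree_sym hT) minnC. Qed.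

Lemma radial_is_weight (w : nat -> R) : (forall n, 0 < w n) -> is_weight E (radial_weight w).
Proof.
move=> w0; split; first exact: radial_weight_sym.
  by move=> x y xy; rewrite /radial_weight xy divr_gt0// size_sphere_gt0.
by move=> x y /negbTE xy; rewrite /radial_weight xy.
Qed.

Lemma other_neighbor x y z : child E o x y -> E y z -> z != x -> child E o y z.
Proof.
move=> xy yz zx; case/orP: (edge_child o hT yz) => // zy.
by rewrite (parent_unique hT zy xy) eqxx in zx.
Qed.

Lemma root_child y : E o y -> child E o o y.
Proof.
by move=> /(edge_child o hT) /orP[//|/depth_child]; rewrite (depth_root o hT).
Qed.

Lemma depthS_parent x k : depth E o x = k.+1 -> exists2 y, child E o y x & depth E o y = k.
Proof.
move=> dx; have [|y yx] := @parent_exists _ _ o hT x.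
  by move=> xo; rewrite xo (depth_root o hT) in dx.
by exists y => //; move: (depth_child yx); rewrite dx => -[].
Qed.

Lemma children_total (w : nat -> R) k (n := (size (sphere E o k.+1))%:R : R) :
  N.-1%:R * (w k.+1 / (size (sphere E o k.+2))%:R) = w k.+1 / n.
Proof.
have n0 := size_sphere_gt0 k; rewrite size_sphereSS natrM -/n; field.
by rewrite !gt_eqF// natN1_gt0.
Qed.

Lemma radial_vmeasureS (w : nat -> R) x k : depth E o x = k.+1 ->
  vmeasure E (radial_weight w) x = (w k + w k.+1) / (size (sphere E o k.+1))%:R.
Proof.
move=> dx; have [y yx dy] := depthS_parent dx.
rewrite (@vmeasureE _ _ y (w k.+1 / (size (sphere E o k.+2))%:R)).
- by rewrite children_total radial_weight_sym (radial_weight_child w yx) dy mulrDl.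
- by rewrite (tree_sym hT) (child_edge hT yx).
- by move=> z xz zy; rewrite (radial_weight_child w (other_neighbor yx xz zy)) dx.
Qed.

Lemma radial_vmeasure0 (w : nat -> R) : vmeasure E (radial_weight w) o = w 0%N.
Proof.
have [y oy] := child_exists o.
have c z : E o z -> radial_weight w o z = w 0%N / N%:R.
  by move=> /root_child oz; rewrite (radial_weight_child w oz) (depth_root o hT) size_sphere1.
have Eoy := child_edge hT oy.
rewrite (@vmeasureE _ _ y (w 0%N / N%:R) Eoy) ?c//; last by move=> z /c.
have -> : N%:R = 1 + N.-1%:R :> R by rewrite nat1r prednK//; lia.
by field; rewrite gt_eqF// addr_gt0// natN1_gt0.
Qed.

Lemma radial_ball (w : nat -> R) n :
  smeasure E (radial_weight w) (gball E o n) =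
  \sum_(0 <= k < n.+1) w k + \sum_(0 <= k < n) w k.
Proof.
rewrite /smeasure (sum_ball o hT hN) big_nat_recl// big_seq1 radial_vmeasure0.
rewrite [in RHS]big_nat_recl// -addrA -big_split; congr +%R.
apply: eq_bigr => k _; rewrite big_seq (eq_bigr
    (fun=> (w k + w k.+1) / (size (sphere E o k.+1))%:R)); last first.
  by move=> x; rewrite (mem_sphere o hT hN) => /eqP /(radial_vmeasureS w).
rewrite -big_seq big_const_seq count_predT iter_addr_0 -[LHS]mulr_natr divfK.
  by rewrite addrC.
by rewrite gt_eqF// size_sphere_gt0.
Qed.

Definition step_grad (w f : nat -> R) (k : nat) : R :=
  Num.sqrt ((w k * (f k - f k.+1) ^+ 2 + w k.+1 * (f k.+1 - f k.+2) ^+ 2)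
            / (2 * (w k + w k.+1))).

(** The root has no parent, and all its neighbors are alike: there the
    laplacian is [f 1 - f 0] and the gradient [(f 0 - f 1) / sqrt 2], which is
    the separate first condition. *)
Lemma radial_solution (w f : nat -> R) (p q : R) :
  (forall n, 0 < w n) -> (forall n, 0 < f n) -> (forall n, f n.+1 < f n) ->
  f 0%N `^ p * ((f 0%N - f 1%N) / Num.sqrt 2) `^ q <= f 0%N - f 1%N ->
  (forall k, f k.+1 `^ p * step_grad w f k `^ q <=
     (w k.+1 * (f k.+1 - f k.+2) - w k * (f k - f k.+1)) / (w k + w k.+1)) ->
  nontrivial_positive_solution E (radial_weight w) p q (fun x => f (depth E o x)).
Proof.
move=> w0 f0 df root step.
have wp := radial_is_weight w0.
split; first by move=> x.
  move=> [c fc]; have [y oy] := child_exists o.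
  move: (df 0%N); rewrite -(depth_root o hT) -(depth_child oy) !fc.
  by rewrite ltxx.
move=> x; case dx : (depth E o x) => [|k].
  have xo := depth_eq0 hT dx; subst x; have [y oy] := child_exists o.
  have c z : E o z -> radial_weight w o z = w 0%N / N%:R /\ f (depth E o z) = f 1%N.
    move=> /root_child oz; rewrite (depth_child oz) (radial_weight_child w oz).
    by rewrite (depth_root o hT) size_sphere1.
  have Nn0 : 0 < N%:R :> R by rewrite ltr0n; lia.
  have b0 : 0 < w 0%N / N%:R by rewrite divr_gt0.
  have [cy fy] := c _ (child_edge hT oy).
  rewrite -[f 0%N]/((fun n => f n) 0%N) -dx.
  have := @vertex_inequality (radial_weight w) (fun x => f (depth E o x)) p q o y
    (w 0%N / N%:R) (f 1%N) (child_edge hT oy); rewrite /= cy fy dx; apply => //.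
  + by move=> z oz _; exact: c.
  + by rewrite lt_eqF.
  + have n0 := natN1_gt0; move: (N.-1%:R) n0 => n n0.
    set b := w 0%N / N%:R in b0 *.
    have -> : (b * (f 0%N - f 1%N) + n * b * (f 0%N - f 1%N)) / (b + n * b) = f 0%N - f 1%N.
      by field; rewrite gt_eqF//; nra.
    have -> : (b * (f 1%N - f 0%N) ^+ 2 + n * b * (f 1%N - f 0%N) ^+ 2) /
      (2 * (b + n * b)) = (f 0%N - f 1%N) ^+ 2 / 2.
      by field; rewrite gt_eqF//; nra.
    by rewrite sqrtrM ?sqr_ge0// sqrtrV// sqrtr_sqr gtr0_norm// subr_gt0.
have [y yx dy] := depthS_parent dx.
set n := (size (sphere E o k.+1))%:R : R; have n0 : 0 < n := size_sphere_gt0 k.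
set b := w k.+1 / (size (sphere E o k.+2))%:R.
have tot : N.-1%:R * b = w k.+1 / n by exact: children_total.
have ma : radial_weight w x y = w k / n.
  by rewrite radial_weight_sym (radial_weight_child w yx) dy.
have xy : E x y by rewrite (tree_sym hT) (child_edge hT yx).
have := @vertex_inequality (radial_weight w) (fun x => f (depth E o x)) p q x y
  b (f k.+2) xy; rewrite /= ma tot dx dy; apply.
- by rewrite divr_gt0.
- by rewrite divr_gt0// size_sphere_gt0.
- move=> z xz zy; have xz' := other_neighbor yx xz zy.
  by rewrite (radial_weight_child w xz') (depth_child xz') dx.
- by rewrite gt_eqF.
have ww : 0 < w k + w k.+1 by rewrite addr_gt0.
have -> : (w k / n * (f k.+1 - f k) + w k.+1 / n * (f k.+1 - f k.+2)) /
  (w k / n + w k.+1 / n) =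
  (w k.+1 * (f k.+1 - f k.+2) - w k * (f k - f k.+1)) / (w k + w k.+1).
  by field; rewrite !gt_eqF.
suff -> : (w k / n * (f k - f k.+1) ^+ 2 + w k.+1 / n * (f k.+2 - f k.+1) ^+ 2) /
  (2 * (w k / n + w k.+1 / n)) =
  (w k * (f k - f k.+1) ^+ 2 + w k.+1 * (f k.+1 - f k.+2) ^+ 2) / (2 * (w k + w k.+1)).
  exact: step.
by field; rewrite !gt_eqF.
Qed.

End SolutionsOnTheTree.

(** * Horofunction weights and solutions *)

Section Horofunction.
Variables (R : realType) (N : nat) (V : choiceType) (E : rel V) (o : V).
Hypothesis N2 : (2 <= N)%N.
Hypothesis hE : homogeneous_tree N E.

Let hT : is_tree E := hE.1.
Let hN : forall x, (neighbors E x #= `I_N)%card := hE.2.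

Definition heir (x : V) : V := xget x [set y | child E o x y]%classic.

Definition ray (n : nat) : V := iter n heir o.

Definition on_ray (x : V) : bool := x == ray (depth E o x).

(** The horofunction of the ray, normalized at [o]: along the path from [o]
    the height decreases by one as long as the path follows the ray, and then
    increases by one at each step. *)
Definition height (x : V) : R :=
  (depth E o x)%:R - 2 * (count on_ray (tpath E o x))%:R.

Lemma heirP x : child E o x (heir x).
Proof. exact: (xgetPex x (child_exists o N2 hE x)). Qed.

Lemma on_ray_child x y : child E o x y -> on_ray y = on_ray x && (y == heir x).
Proof.
move=> xy; rewrite /on_ray (depth_child xy).
rewrite -[ray _.+1]/(heir (ray (depth E o x))).
apply/idP/andP => [/eqP ye|[/eqP <-]//].
suff rx : ray (depth E o x) = x by rewrite ye rx !eqxx.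
by apply: (parent_unique hT (heirP _)); rewrite -ye.
Qed.

Lemma on_ray_root : on_ray o.
Proof. by rewrite /on_ray (depth_root o hT). Qed.

Lemma height_child x y : child E o x y ->
  height y = if on_ray y then height x - 1 else height x + 1.
Proof.
move=> xy; rewrite /height (depth_child xy) (eqP xy) -cats1 count_cat natrD /=.
by rewrite -natr1; case: (on_ray y) => /=; rewrite ?addn0; ring.
Qed.

(** Along the ray the neighbor at the smaller height is the next vertex of the
    ray; elsewhere it is the parent. *)
Lemma height_neighbors x : exists a, [/\ E x a, height a = height x - 1
  & forall y, E x y -> y != a -> height y = height x + 1].
Proof.
have [xr|xr] := boolP (on_ray x).
  exists (heir x); split; first exact: child_edge (heirP x).
    by rewrite (height_child (heirP x)) (on_ray_child (heirP x)) xr eqxx.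
  move=> y xy ya; case/orP: (edge_child o hT xy) => c.
    by rewrite (height_child c) (on_ray_child c) xr (negbTE ya).
  by rewrite (height_child c) xr subrK.
have [|a ax] := @parent_exists _ _ o hT x.
  by move=> xo; rewrite xo on_ray_root in xr.
exists a; split.
- by rewrite (tree_sym hT) (child_edge hT ax).
- by rewrite (height_child ax) (negbTE xr) addrK.
move=> y xy ya; have c := other_neighbor hE ax xy ya.
by rewrite (height_child c) (on_ray_child c) (negbTE xr).
Qed.

Variable l : R.
Hypothesis l0 : 0 <= l.

Local Notation s := (expR l).
Local Notation S := (N.-1%:R * s).

Definition horo_weight (x y : V) : R :=
  if E x y then expR (l * Num.min (height x) (height y)) else 0.

Lemma horo_is_weight : is_weight E horo_weight.
Proof.
split=> [x y|x y xy|x y /negbTE xy]; rewrite /horo_weight.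
- by rewrite (tree_sym hT) minC.
- by rewrite xy expR_gt0.
- by rewrite xy.
Qed.

Lemma horo_weight_down x a : E x a -> height a = height x - 1 ->
  horo_weight x a = expR (l * height x) / s.
Proof.
move=> xa ha; rewrite /horo_weight xa ha min_r; last by rewrite gerBl.
by rewrite mulrBr mulr1 expRB.
Qed.

Lemma horo_weight_up x y : E x y -> height y = height x + 1 ->
  horo_weight x y = expR (l * height x).
Proof. by move=> xa ha; rewrite /horo_weight xa ha min_l// lerDl. Qed.

Lemma horo_vmeasure x : vmeasure E horo_weight x = (1 + S) / s * expR (l * height x).
Proof.
have [a [xa ha hy]] := height_neighbors x.
rewrite (vmeasureE hE (b := expR (l * height x)) xa); last first.
  by move=> y xy ya; rewrite (horo_weight_up xy (hy _ xy ya)).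
by rewrite (horo_weight_down xa ha); field; rewrite gt_eqF// expR_gt0.
Qed.

Let s1 : 1 <= s.
Proof. by rewrite -expR0 ler_expR. Qed.

Let n0 : 0 < N.-1%:R :> R.
Proof. exact: natN1_gt0. Qed.

Let S0 : 0 < S.
Proof. by rewrite mulr_gt0// expR_gt0. Qed.

Let A (k : nat) : R := \sum_(x <- sphere E o k) expR (l * height x).

(** No child is higher than its parent by more than one. The factor 2 pays for
    the root, which has one child more than the other vertices. *)
Lemma horo_sphere_le k : A k <= 2 * S ^+ k.
Proof.
have kids x : \sum_(y <- children E o x) expR (l * height y) <=
    (size (children E o x))%:R * (s * expR (l * height x)).
  rewrite mulr_natl -[leRHS]addr0 -iter_addr -count_predT -big_const_seq.
  rewrite big_seq [leRHS]big_seq ler_sum// => y.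
  rewrite (mem_children o hT hN) => xy; rewrite -expRD ler_expR (height_child xy).
  case: ifP => _; last by rewrite mulrDr mulr1 addrC.
  by rewrite mulrBr mulr1; move: l0; lra.
have N1 : N%:R = 1 + N.-1%:R :> R by rewrite nat1r prednK//; lia.
have n1 : 1 <= N.-1%:R :> R by rewrite ler1n; lia.
have h0 : height o = 0 by rewrite /height (depth_root o hT) (tpath_root o hT) mulr0 subr0.
case: k => [|k]; first by rewrite /A big_seq1 h0 mulr0 expR0; lra.
elim: k => [|k IH].
  rewrite /A sum_sphereS big_seq1; apply: (le_trans (kids o)).
  rewrite (size_children o hT hN) eqxx h0 mulr0 expR0 expr1 N1.
  by move: s1 n1; nra.
rewrite /A sum_sphereS exprS mulrCA.
apply: (@le_trans _ _ (S * A k.+1)); last by rewrite ler_wpM2l// ltW.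
rewrite big_distrr/= big_seq [leRHS]big_seq ler_sum// => x.
rewrite -[flatten _]/(sphere E o k.+1) (mem_sphere o hT hN) => /eqP dx.
apply: (le_trans (kids x)); rewrite (size_children o hT hN) -mulrA.
by case: eqP dx => // ->; rewrite (depth_root o hT).
Qed.

(** The vertices off the ray suffice: all their children go up, which
    multiplies their sum by [S], and the branches that leave the ray later only
    add to it. *)
Lemma horo_sphere_ge k : S ^+ k.+1 <= A k.+1.
Proof.
pose b x := if on_ray x then 0 else expR (l * height x).
have bA j : \sum_(x <- sphere E o j) b x <= A j.
  by apply: ler_sum => x _; rewrite /b; case: ifP => // _; exact: expR_ge0.
apply: le_trans (bA _); have b0 x : 0 <= b x by rewrite /b; case: ifP => // _; exact: expR_ge0.
have up x y : child E o x y -> ~~ on_ray y -> b y = s * expR (l * height x).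
  move=> xy yr; rewrite /b (negbTE yr) -expRD (height_child xy) (negbTE yr).
  by rewrite mulrDr mulr1 addrC.
have h0 : height o = 0 by rewrite /height (depth_root o hT) (tpath_root o hT) mulr0 subr0.
elim: k => [|k IH].
  rewrite sum_sphereS big_seq1 expr1.
  have hc : heir o \in children E o o by rewrite (mem_children o hT hN) heirP.
  rewrite (perm_big _ (perm_to_rem hc)) big_cons.
  rewrite (eq_big_seq (fun=> s)) => [|y]; last first.
    rewrite mem_rem_uniq ?children_uniq// !inE (mem_children o hT hN) => /andP[yo oy].
    rewrite (up _ _ oy) ?(on_ray_child oy) ?(negbTE yo) ?andbF//.
    by rewrite h0 mulr0 expR0 mulr1.
  rewrite big_const_seq count_predT size_rem// (size_children o hT hN) eqxx iter_addr_0.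
  by rewrite mulr_natl lerDr.
rewrite exprS; apply: (@le_trans _ _ (S * \sum_(x <- sphere E o k.+1) b x)).
  by rewrite ler_wpM2l// ltW.
rewrite [leRHS]sum_sphereS big_distrr/=.
rewrite big_seq [leRHS]big_seq ler_sum// => x.
rewrite -[flatten _]/(sphere E o k.+1) (mem_sphere o hT hN) => /eqP dx.
rewrite {1}/b; case: ifP => xr; first by rewrite mulr0 sumr_ge0.
rewrite (eq_big_seq (fun=> s * expR (l * height x))) => [|y]; last first.
  rewrite (mem_children o hT hN) => xy.
  by rewrite (up _ _ xy)// (on_ray_child xy) xr.
rewrite big_const_seq count_predT (size_children o hT hN) iter_addr_0 -mulrA.
case: eqP dx => [->|_ _]; first by rewrite (depth_root o hT).
by rewrite mulr_natl.
Qed.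

Lemma horo_ball : 1 < S ->
  asymp (fun n => smeasure E horo_weight (gball E o n)) (fun n => S ^+ n).
Proof.
move=> S1; have c0 : 0 < (1 + S) / s by rewrite divr_gt0 ?expR_gt0 ?addr_gt0.
have ballE n : smeasure E horo_weight (gball E o n) =
    (1 + S) / s * \sum_(0 <= k < n.+1) A k.
  rewrite /smeasure (sum_ball o hT hN) big_distrr; apply: eq_bigr => k _.
  by rewrite big_distrr; apply: eq_bigr => x _; exact: horo_vmeasure.
have A0 k : 0 <= A k by apply: sumr_ge0 => x _; exact: expR_ge0.
have S10 : 0 < S - 1 by rewrite subr_gt0.
exists ((1 + S) / s * (2 * S / (S - 1))), ((1 + S) / s)^-1; split.
- by rewrite mulr_gt0// divr_gt0// mulr_gt0.
- by rewrite invr_gt0.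
move=> n n2; rewrite ballE; have Sn : 0 < S ^+ n by rewrite exprn_gt0.
have lo : S ^+ n <= \sum_(0 <= k < n.+1) A k.
  case: n n2 Sn => // n _ _; rewrite big_nat_recr//=.
  by rewrite (le_trans (horo_sphere_ge n))// lerDr sumr_ge0.
split.
  rewrite ler_pdivrMr// -[leRHS]mulrA ler_pM2l//.
  apply: (@le_trans _ _ (\sum_(0 <= k < n.+1) 2 * S ^+ k)).
    by apply: ler_sum => k _; exact: horo_sphere_le.
  rewrite -big_distrr/=.
  have -> : 2 * S / (S - 1) * S ^+ n = 2 * (S ^+ n.+1 / (S - 1)).
    by rewrite exprS; ring.
  by rewrite ler_pM2l// ler_pdivlMr// mulrC big_mkord -subrX1 gerBl.
rewrite ler_pdivrMr; last exact: mulr_gt0 c0 (lt_le_trans Sn lo).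
by rewrite mulKf// gt_eqF.
Qed.

(** At every vertex the downward edge and the upward edges carry weights in the
    ratio [1 : S], so the inequality is the same everywhere after division by
    [u x], which is possible because [p + q = 1]. *)
Lemma horo_solution (p q t : R) (T := expR t) : p + q = 1 -> 0 < t ->
  Num.sqrt (((T - 1) ^+ 2 + S * (1 - T^-1) ^+ 2) / (2 * (1 + S))) `^ q <=
    (S * (1 - T^-1) - (T - 1)) / (1 + S) ->
  nontrivial_positive_solution E horo_weight p q (fun x => expR (- t * height x)).
Proof.
move=> pq t0 le; have T1 : 1 < T by rewrite /T expR_gt1.
have T0 : 0 < T by apply: lt_trans T1.
split=> [x||x]; first exact: expR_gt0.
  move=> [c cE]; have [a [_ ha _]] := height_neighbors o.
  have := cE a; rewrite -(cE o) => /expR_inj; rewrite ha; nra.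
have [a [xa ha hy]] := height_neighbors x.
set u := expR (- t * height x); have u0 : 0 < u by exact: expR_gt0.
have ua : expR (- t * height a) = u * T.
  by rewrite -expRD ha; congr expR; ring.
have ub y : E x y -> y != a -> expR (- t * height y) = u / T.
  by move=> xy ya; rewrite -expRB (hy _ xy ya); congr expR; ring.
set e := expR (l * height x); have e0 : 0 < e by exact: expR_gt0.
have := @vertex_inequality _ _ _ _ N2 hE horo_weight (fun x => expR (- t * height x)) p q x a
  e (u / T) xa; rewrite /= (horo_weight_down xa ha) -/e -/u ua; apply => //.
- by rewrite divr_gt0// expR_gt0.
- by move=> y xy ya; rewrite (horo_weight_up xy (hy _ xy ya)) ub.
- by rewrite -subr_eq0 -{2}(mulr1 u) -mulrBr mulf_neq0 ?gt_eqF ?subr_gt0.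
have sn : 0 < s := expR_gt0 l.
have -> : N.-1%:R * e = e / s * S by field; rewrite gt_eqF.
set c := e / s; have c0 : 0 < c by rewrite divr_gt0.
have S10 : 0 < 1 + S by rewrite addr_gt0.
have cS : 0 < c + c * S := addr_gt0 c0 (mulr_gt0 c0 S0).
have -> : (c * (u * T - u) ^+ 2 + c * S * (u / T - u) ^+ 2) / (2 * (c + c * S)) =
   u ^+ 2 * (((T - 1) ^+ 2 + S * (1 - T^-1) ^+ 2) / (2 * (1 + S))).
  by field; rewrite !gt_eqF.
have -> : (c * (u - u * T) + c * S * (u - u / T)) / (c + c * S) =
   u * ((S * (1 - T^-1) - (T - 1)) / (1 + S)).
  by field; rewrite !gt_eqF.
rewrite sqrtrM ?sqr_ge0// sqrtr_sqr gtr0_norm// powRM ?sqrtr_ge0 ?(ltW u0)//.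
rewrite mulrA -powRD; last by rewrite pq oner_eq0.
by rewrite pq powRr1 ?(ltW u0)// ler_pM2l.
Qed.

End Horofunction.

(** * Comparison up to constants of sequences *)

Section Comparison.
Variable R : realType.
Implicit Types f g h : nat -> R.

Definition dominated f g := exists2 C : R, 0 < C & forall n, f n <= C * g n.

Definition commensurate f g := dominated f g /\ dominated g f.

Lemma dominated_trans f g h : dominated f g -> dominated g h -> dominated f h.
Proof.
move=> [C C0 fg] [D D0 gh]; exists (C * D); first exact: mulr_gt0.
by move=> n; rewrite (le_trans (fg n))// -mulrA ler_pM2l.
Qed.

Lemma dominated_le f g : (forall n, f n <= g n) -> dominated f g.
Proof. by move=> fg; exists 1 => // n; rewrite mul1r. Qed.

Lemma dominatedD f g h : dominated f h -> dominated g h ->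
  dominated (fun n => f n + g n) h.
Proof.
move=> [C C0 fh] [D D0 gh]; exists (C + D); first exact: addr_gt0.
by move=> n; rewrite mulrDl lerD.
Qed.

Lemma dominatedM f f' g g' : (forall n, 0 < f n) -> (forall n, 0 < f' n) ->
  dominated f g -> dominated f' g' ->
  dominated (fun n => f n * f' n) (fun n => g n * g' n).
Proof.
move=> f0 f0' [C C0 fg] [D D0 fg']; exists (C * D); first exact: mulr_gt0.
by move=> n; rewrite mulrACA ler_pM// ltW.
Qed.

Lemma dominatedZ (c : R) f g : 0 < c -> dominated f g ->
  dominated (fun n => c * f n) g.
Proof.
move=> c0 [C C0 fg]; exists (c * C); first exact: mulr_gt0.
by move=> n; rewrite -mulrA ler_pM2l.
Qed.

Lemma dominated_sum f g : dominated f g ->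
  dominated (fun n => \sum_(0 <= k < n.+1) f k) (fun n => \sum_(0 <= k < n.+1) g k).
Proof.
by move=> [C C0 fg]; exists C => // n; rewrite big_distrr ler_sum.
Qed.

(** Both bounds are used, since a negative exponent reverses the order. *)
Lemma dominated_powR f g c : (forall n, 0 < f n) -> (forall n, 0 < g n) ->
  commensurate f g -> dominated (fun n => f n `^ c) (fun n => g n `^ c).
Proof.
move=> f0 g0 [[C C0 fg] [D D0 gf]]; have [c0|c0] := lerP 0 c.
  exists (C `^ c) => [|n]; first exact: powR_gt0.
  rewrite -(powRM _ (ltW C0) (ltW (g0 n))).
  by rewrite ge0_ler_powR ?nnegrE// ltW// mulr_gt0.
exists (D `^ (- c)) => [|n]; first exact: powR_gt0.
rewrite -(opprK c) !(powRN _ (- c)) opprK ler_pdivlMr ?powR_gt0//.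
rewrite mulrC ler_pdivrMr ?powR_gt0// -(powRM _ (ltW D0) (ltW (f0 n))).
by rewrite ge0_ler_powR ?nnegrE// ltW// ?mulr_gt0// oppr_gt0.
Qed.

Lemma commensurate_sym f g : commensurate f g -> commensurate g f.
Proof. by case. Qed.

Lemma commensurate_refl f : commensurate f f.
Proof. by split; exact: dominated_le. Qed.

Lemma commensurate_trans f g h : commensurate f g -> commensurate g h -> commensurate f h.
Proof. by move=> [fg gf] [gh hg]; split; apply: dominated_trans; eassumption. Qed.

Lemma commensurateM f f' g g' :
  (forall n, 0 < f n) -> (forall n, 0 < f' n) ->
  (forall n, 0 < g n) -> (forall n, 0 < g' n) ->
  commensurate f g -> commensurate f' g' ->
  commensurate (fun n => f n * f' n) (fun n => g n * g' n).
Proof. by move=> f0 f'0 g0 g'0 [fg gf] [f'g' g'f']; split; exact: dominatedM. Qed.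

Lemma commensurate_powR f g c : (forall n, 0 < f n) -> (forall n, 0 < g n) ->
  commensurate f g -> commensurate (fun n => f n `^ c) (fun n => g n `^ c).
Proof. by move=> f0 g0 fg; split; apply: dominated_powR => //; exact: commensurate_sym. Qed.

Lemma commensurateV f g : (forall n, 0 < f n) -> (forall n, 0 < g n) ->
  commensurate f g -> commensurate (fun n => (f n)^-1) (fun n => (g n)^-1).
Proof.
move=> f0 g0 /(commensurate_powR (-1) f0 g0).
have pow h : (forall n, 0 < h n) -> (fun n => h n `^ (-1)) = (fun n => (h n)^-1).
  by move=> h0; apply/funext => n; rewrite powR_inv1// ltW.
by rewrite !pow.
Qed.

Lemma commensurate_sum f g : commensurate f g ->
  commensurate (fun n => \sum_(0 <= k < n.+1) f k) (fun n => \sum_(0 <= k < n.+1) g k).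
Proof. by move=> [fg gf]; split; exact: dominated_sum. Qed.

Lemma ln_increment (x y : R) : 0 < x -> x <= y ->
  (y - x) / y <= ln y - ln x <= (y - x) / x.
Proof.
move=> x0 xy; have y0 : 0 < y by exact: lt_le_trans xy.
rewrite -ln_div ?posrE//; apply/andP; split.
  rewrite -[leLHS]opprK lerNl -lnV ?posrE ?divr_gt0// invf_div.
  have -> : x / y = 1 + - ((y - x) / y) by field; rewrite gt_eqF.
  by apply: le_ln1Dx; rewrite ltrN2 ltr_pdivrMr// mul1r gtrBl.
have -> : y / x = 1 + (y - x) / x by field; rewrite gt_eqF.
by apply: le_ln1Dx; rewrite (@lt_le_trans _ _ 0)// divr_ge0 ?subr_ge0// ltW.
Qed.

Lemma expR_increment (x y : R) :
  expR x * (y - x) <= expR y - expR x <= expR y * (y - x).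
Proof.
have H (a b : R) : expR a * (b - a) <= expR b - expR a.
  have -> : expR b = expR a * expR (b - a) by rewrite -expRD addrC subrK.
  rewrite -{3}(mulr1 (expR a)) -mulrBr ler_pM2l ?expR_gt0// lerBrDl.
  exact: expR_ge1Dx.
by rewrite H/= -lerN2 !(opprB, =^~ mulrN) H.
Qed.

End Comparison.

(** * Sequences that grow like monomials in n and ln n *)

Section LogPolynomialSequences.
Variable R : realType.

(** The shift by 2 makes the logarithm positive for every [n]. *)
Definition lnshift (n : nat) : R := ln n.+2%:R.

Definition monlog (a b : R) (n : nat) : R := n.+2%:R `^ a * lnshift n `^ b.

Let X0 n : 0 < n.+2%:R :> R.
Proof. by rewrite ltr0n. Qed.

Lemma lnshift_gt0 n : 0 < lnshift n.
Proof. by rewrite ln_gt0// ltr1n. Qed.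

Let L0 n : 0 < lnshift n.
Proof. exact: lnshift_gt0. Qed.

Lemma lnshift_homo m n : (m <= n)%N -> lnshift m <= lnshift n.
Proof. by move=> mn; rewrite ler_ln ?posrE ?X0// ler_nat !ltnS. Qed.

Lemma monlog_gt0 a b n : 0 < monlog a b n.
Proof. by rewrite mulr_gt0// powR_gt0. Qed.

Lemma monlogM a b c d n : monlog a b n * monlog c d n = monlog (a + c) (b + d) n.
Proof. by rewrite /monlog mulrACA -!powRD// ?(gt_eqF (X0 n)) ?(gt_eqF (L0 n)) implybT. Qed.

Lemma monlog_powR a b c n : monlog a b n `^ c = monlog (a * c) (b * c) n.
Proof. by rewrite /monlog powRM ?powR_ge0// -!powRrM. Qed.

Lemma monlogV a b n : (monlog a b n)^-1 = monlog (- a) (- b) n.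
Proof. by rewrite /monlog invfM !powRN. Qed.

Lemma monlog_expR a b n : monlog a b n = expR (a * lnshift n + b * ln (lnshift n)).
Proof. by rewrite expRD /monlog /powR !gt_eqF. Qed.

Lemma natS_commensurate : commensurate (fun n => n.+3%:R : R) (fun n => n.+2%:R : R).
Proof.
split; last by apply: dominated_le => n; rewrite ler_nat.
by exists 2 => // n; rewrite -natrM ler_nat; lia.
Qed.

(** Doubling is enough because [n + 3 <= (n + 2)^2]. *)
Lemma lnshiftS_commensurate : commensurate (fun n => lnshift n.+1) lnshift.
Proof.
split; last by apply: dominated_le => n; exact: lnshift_homo.
exists 2 => // n; rewrite mulr_natl -lnXn// ler_ln ?posrE ?exprn_gt0//.
by rewrite -natrX ler_nat; nia.
Qed.

Lemma monlogS_commensurate a b : commensurate (fun n => monlog a b n.+1) (monlog a b).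
Proof.
apply: commensurateM => //; try by move=> n; exact: powR_gt0.
- by apply: (commensurate_powR _ _ _ natS_commensurate).
- by apply: (commensurate_powR _ _ _ lnshiftS_commensurate).
Qed.

Lemma monlog_le a a' b b' : a <= a' -> b <= b' -> dominated (monlog a b) (monlog a' b').
Proof.
move=> aa bb; exists (lnshift 0 `^ (b - b')); first exact: powR_gt0.
move=> n; rewrite /monlog mulrCA ler_pM ?powR_ge0//.
  by rewrite ler_powR// ler1n.
have -> : lnshift n `^ b = lnshift n `^ (b - b') * lnshift n `^ b'.
  by rewrite -powRD ?subrK// (gt_eqF (L0 n)) implybT.
rewrite ler_wpM2r ?powR_ge0//; rewrite -opprB !(powRN _ (b' - b)).
by rewrite lef_pV2 ?posrE ?powR_gt0// ge0_ler_powR ?subr_ge0 ?nnegrE ?(ltW (L0 _))// lnshift_homo.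
Qed.

Lemma ln_step : commensurate (fun n => lnshift n.+1 - lnshift n) (monlog (-1) 0).
Proof.
have m n : monlog (-1) 0 n = n.+2%:R^-1 by rewrite /monlog powRr0 mulr1 powR_inv1.
have st n : n.+3%:R - n.+2%:R = 1 :> R by rewrite -natr1 addrC addKr.
have H n : n.+3%:R^-1 <= lnshift n.+1 - lnshift n <= n.+2%:R^-1.
  have := @ln_increment R n.+2%:R n.+3%:R (X0 n); rewrite ler_nat st !mul1r.
  by apply; lia.
split; first by apply: dominated_le => n; rewrite m; have /andP[] := H n.
exists 2 => // n; rewrite m; have /andP[le _] := H n.
rewrite (@le_trans _ _ (2 * n.+3%:R^-1))// ?ler_pM2l//.
by rewrite ler_pdivlMr// mulrC ler_pdivrMr// -natrM ler_nat; lia.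
Qed.

Lemma lnln_step :
  commensurate (fun n => ln (lnshift n.+1) - ln (lnshift n)) (monlog (-1) (-1)).
Proof.
pose d n := lnshift n.+1 - lnshift n.
have H n : d n / lnshift n.+1 <= ln (lnshift n.+1) - ln (lnshift n) <= d n / lnshift n.
  by apply: ln_increment => //; exact: lnshift_homo.
have d0 n : 0 < d n by rewrite subr_gt0 ltr_ln ?posrE// ltr_nat.
have E : commensurate (fun n => d n / lnshift n) (monlog (-1) (-1)).
  have -> : monlog (-1) (-1) = (fun n => monlog (-1) 0 n * (lnshift n)^-1).
    by apply/funext => n; rewrite /monlog powRr0 mulr1 (powR_inv1 (ltW (L0 n))).
  apply: commensurateM => //; first by move=> n; rewrite invr_gt0.
  - by move=> n; exact: monlog_gt0.
  - by move=> n; rewrite invr_gt0.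
  - exact: ln_step.
  - exact: commensurate_refl.
split.
  apply: dominated_trans E.1; apply: dominated_le => n.
  by have /andP[] := H n.
apply: dominated_trans E.2 _.
apply: (@dominated_trans _ _ (fun n => d n / lnshift n.+1)); last first.
  by apply: dominated_le => n; have /andP[] := H n.
apply: dominatedM => //; first by move=> n; rewrite invr_gt0.
  exact: dominated_le.
apply: (commensurateV _ _ _).1 => //.
exact: commensurate_sym lnshiftS_commensurate.
Qed.

(** Since [monlog a b = expR t] with [t = a ln n + b ln ln n], the increments of
    [monlog a b] are [monlog a b] times those of [t], up to the bounded ratio of
    consecutive terms. *)
Lemma monlog_step a b c d :
  commensurate (fun n => a * (lnshift n.+1 - lnshift n) +
                       b * (ln (lnshift n.+1) - ln (lnshift n))) (monlog c d) ->
  commensurate (fun n => monlog a b n.+1 - monlog a b n) (monlog (a + c) (b + d)).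
Proof.
pose t n := a * lnshift n + b * ln (lnshift n).
have tE n : a * (lnshift n.+1 - lnshift n) + b * (ln (lnshift n.+1) - ln (lnshift n)) =
  t n.+1 - t n by rewrite /t; ring.
under eq_fun do rewrite tE.
move=> [tc ct].
have H n : monlog a b n * (t n.+1 - t n) <= monlog a b n.+1 - monlog a b n <=
    monlog a b n.+1 * (t n.+1 - t n).
  by rewrite !monlog_expR -!/(t _); exact: expR_increment.
have t0 n : 0 < t n.+1 - t n.
  case: ct => C C0 /(_ n); rewrite -ler_pdivrMl//; apply: lt_le_trans.
  by rewrite mulr_gt0 ?invr_gt0// monlog_gt0.
have -> : monlog (a + c) (b + d) = (fun n => monlog a b n * monlog c d n).
  by apply/funext => n; rewrite monlogM.
split.
  apply: (@dominated_trans _ _ (fun n => monlog a b n.+1 * (t n.+1 - t n))).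
    by apply: dominated_le => n; have /andP[] := H n.
  apply: dominatedM => //; first by move=> n; exact: monlog_gt0.
  exact: (monlogS_commensurate a b).1.
apply: (@dominated_trans _ _ (fun n => monlog a b n * (t n.+1 - t n))); last first.
  by apply: dominated_le => n; have /andP[] := H n.
by apply: dominatedM => //; [move=> n; exact: monlog_gt0..|exact: dominated_le].
Qed.

Lemma monlog_step_pow a b : 0 < a -> 0 <= b ->
  commensurate (fun n => monlog a b n.+1 - monlog a b n) (monlog (a - 1) b).
Proof.
move=> a0 b0; rewrite -[b in monlog (a - 1) b]addr0; apply: monlog_step.
have dd0 n : 0 <= ln (lnshift n.+1) - ln (lnshift n).
  by rewrite subr_ge0 ler_ln ?posrE// lnshift_homo.
split; last first.
  case: ln_step => _ [C C0 H]; exists (C / a); first exact: divr_gt0.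
  move=> n; rewrite mulrDr mulrA divfK ?gt_eqF//.
  by rewrite (le_trans (H n))// lerDl !mulr_ge0// ltW// invr_gt0.
apply: dominatedD; first exact: dominatedZ ln_step.1.
move: b0; rewrite le_eqVlt => /predU1P[<-|b0].
  by apply: dominated_le => n; rewrite mul0r ltW// monlog_gt0.
apply: dominatedZ => //; apply: dominated_trans lnln_step.1 _.
by apply: monlog_le => //; rewrite lerN10.
Qed.

Lemma monlog_step_ln b : 0 < b ->
  commensurate (fun n => monlog 0 b n.+1 - monlog 0 b n) (monlog (-1) (b - 1)).
Proof.
move=> b0; rewrite -[X in monlog X (b - 1)]add0r; apply: monlog_step.
under eq_fun do rewrite mul0r add0r.
case: lnln_step => [[C C0 H] [D D0 K]]; split.
  by exists (b * C) => [|n]; [rewrite mulr_gt0|rewrite -mulrA ler_pM2l].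
exists (D / b) => [|n]; first by rewrite divr_gt0.
by rewrite mulrA divfK ?gt_eqF.
Qed.

(** The increments of the inverse sequence are those of the sequence divided by
    the product of two consecutive terms. *)
Lemma monlog_decrease a b c d :
  commensurate (fun n => monlog a b n.+1 - monlog a b n) (monlog c d) ->
  commensurate (fun n => monlog (- a) (- b) n - monlog (- a) (- b) n.+1)
             (monlog (c - 2 * a) (d - 2 * b)).
Proof.
move=> H; have H0 n : 0 < monlog a b n.+1 - monlog a b n.
  case: H => _ [C C0 /(_ n)]; rewrite -ler_pdivrMl//; apply: lt_le_trans.
  by rewrite mulr_gt0 ?invr_gt0// monlog_gt0.
have -> : (fun n => monlog (- a) (- b) n - monlog (- a) (- b) n.+1) =
    (fun n => (monlog a b n.+1 - monlog a b n) *
              (monlog (- a) (- b) n * monlog (- a) (- b) n.+1)).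
  apply/funext => n; rewrite -!monlogV; field.
  by rewrite !gt_eqF// monlog_gt0.
have -> : monlog (c - 2 * a) (d - 2 * b) =
    (fun n => monlog c d n * (monlog (- a) (- b) n * monlog (- a) (- b) n)).
  by apply/funext => n; rewrite !monlogM; congr (monlog _ _ n); ring.
have m0 := monlog_gt0.
apply: commensurateM => //; try by move=> n; rewrite mulr_gt0.
apply: commensurateM => //; first exact: commensurate_refl.
exact: monlogS_commensurate.
Qed.

(** [monlog (a + 1) b] is a discrete primitive of [monlog a b] up to constants,
    so the sum telescopes. *)
Lemma sum_monlog (w : nat -> R) a b : 0 < a + 1 -> 0 <= b -> (forall n, 0 < w n) ->
  commensurate w (monlog a b) ->
  commensurate (fun n => \sum_(0 <= k < n.+1) w k) (monlog (a + 1) b).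
Proof.
move=> a0 b0 w0 wE; have := monlog_step_pow a0 b0; rewrite addrK => st.
have {}wE := commensurate_trans wE (commensurate_sym st).
have tel n : \sum_(0 <= k < n.+1) (monlog (a + 1) b k.+1 - monlog (a + 1) b k) =
   monlog (a + 1) b n.+1 - monlog (a + 1) b 0.
  by rewrite telescope_sumr.
have [D1 D2] := commensurate_sum wE.
split.
  apply: dominated_trans D1 _; apply: dominated_trans (monlogS_commensurate _ _).1.
  by apply: dominated_le => n; rewrite tel gerBl ltW// monlog_gt0.
apply: dominated_trans (monlogS_commensurate _ _).2 _.
apply: (@dominated_trans _ _ (fun n =>
   \sum_(0 <= k < n.+1) (monlog (a + 1) b k.+1 - monlog (a + 1) b k)
   + monlog (a + 1) b 0)).
  by apply: dominated_le => n; rewrite tel subrK.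
apply: dominatedD => //.
exists (monlog (a + 1) b 0 / w 0%N) => [|n]; first by rewrite divr_gt0// monlog_gt0.
rewrite -mulrA ler_peMr ?(ltW (monlog_gt0 _ _ _))// ler_pdivlMl// mulr1.
by rewrite big_nat_recl// lerDl sumr_ge0// => k _; exact: ltW.
Qed.

(** [monlog a b n] is the model sequence at [n + 2], so the balls have to be
    compared across two shifts. *)
Lemma asymp_monlog (B : nat -> R) a b :
  (forall n, 0 < B n) -> commensurate B (monlog a b) ->
  asymp B (fun n => n%:R `^ a * ln n%:R `^ b).
Proof.
move=> B0 BE; have [[C C0 S1] [D D0 S2]] := monlogS_commensurate a b.
case: BE => [[C' C'0 B1] [D' D'0 B2]].
have m0 := monlog_gt0; have C2 : 0 < C * C by exact: mulr_gt0.
have D2 : 0 < D * D by exact: mulr_gt0.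
exists (C' * (C * C)), (D * D * D'); split; try exact: mulr_gt0.
case=> [//|[//|n]] _; rewrite -/(lnshift n) -/(monlog a b n); split.
  rewrite ler_pdivrMr// (le_trans (B1 _))// -mulrA ler_pM2l// -mulrA.
  by rewrite (le_trans (S1 _))// ler_pM2l.
rewrite ler_pdivrMr// (le_trans (S2 _))// -!mulrA ler_pM2l//.
by rewrite (le_trans (S2 _))// ler_pM2l.
Qed.

End LogPolynomialSequences.

(** * Radial profiles and their scaling *)

Section RadialProfiles.
Variable R : realType.
Implicit Types w f : nat -> R.

Definition decr f n : R := f n - f n.+1.

(** In the last condition the left-hand side is comparable to
    [(w n + w n.+1) * f n.+1 ^ r * |grad f| ^ q] at distance [n+1], and the
    right-hand side is the flux increment there. *)
Definition admissible (r q : R) w f : Prop :=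
  [/\ forall n, 0 < w n, forall n, 0 < f n, forall n, 0 < decr f n,
      commensurate (fun n => w n.+1) w /\ commensurate (fun n => decr f n.+1) (decr f)
    & dominated (fun n => w n * f n.+1 `^ r * decr f n `^ q)
                (fun n => w n.+1 * decr f n.+1 - w n * decr f n)].

(** The squared gradient is half the weighted mean of the squares of two
    consecutive decrements. *)
Lemma step_grad_commensurate w f :
  (forall n, 0 < w n) -> (forall n, 0 < decr f n) ->
  commensurate (fun n => decr f n.+1) (decr f) ->
  commensurate (step_grad w f) (decr f).
Proof.
move=> w0 g0 [[C C0 gC] [D D0 gD]].
pose K := 1 + C + D; have K1 : 1 <= K by rewrite /K; lra.
have K0 : 0 < K by apply: lt_le_trans K1.
have H n : (decr f n / (2 * K)) ^+ 2 <= (w n * decr f n ^+ 2 + w n.+1 * decr f n.+1 ^+ 2)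
    / (2 * (w n + w n.+1)) <= (K * decr f n) ^+ 2.
  have a0 := w0 n; have b0 := w0 n.+1; have x0 := g0 n; have y0 := g0 n.+1.
  have yx : decr f n.+1 <= K * decr f n.
    by rewrite (le_trans (gC n))// ler_wpM2r ?(ltW x0)// /K; lra.
  have xy : decr f n / K <= decr f n.+1.
    rewrite ler_pdivrMr// mulrC (le_trans (gD n))// ler_wpM2r ?(ltW y0)// /K; lra.
  set x := decr f n in x0 yx xy *; set y := decr f n.+1 in y0 yx xy *.
  set a := w n in a0 *; set b := w n.+1 in b0 *.
  have xKx : x / K <= x by rewrite ler_pdivrMr// ler_peMr// ltW.
  have xK : x <= K * x by rewrite ler_peMl// ltW.
  have xK0 : 0 < x / K by exact: divr_gt0.
  have ab : 0 < 2 * (a + b) by rewrite mulr_gt0// addr_gt0.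
  have x2 : x ^+ 2 <= (K * x) ^+ 2 by rewrite ler_sqr ?nnegrE// ltW// mulr_gt0.
  have y2 : y ^+ 2 <= (K * x) ^+ 2 by rewrite ler_sqr ?nnegrE// ltW// mulr_gt0.
  have x2' : (x / K) ^+ 2 <= x ^+ 2 by rewrite ler_sqr ?nnegrE// ltW.
  have y2' : (x / K) ^+ 2 <= y ^+ 2 by rewrite ler_sqr ?nnegrE// ltW.
  have -> : x / (2 * K) = (x / K) / 2 by field; rewrite gt_eqF.
  rewrite expr_div_n ler_pdivlMr// ler_pdivrMr//.
  have [P1 P2] : a * (x / K) ^+ 2 <= a * x ^+ 2 /\ b * (x / K) ^+ 2 <= b * y ^+ 2.
    by rewrite !ler_pM2l.
  have [P3 P4] : a * x ^+ 2 <= a * (K * x) ^+ 2 /\ b * y ^+ 2 <= b * (K * x) ^+ 2.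
    by rewrite !ler_pM2l.
  have P5 : 0 <= a * (K * x) ^+ 2 by rewrite mulr_ge0 ?sqr_ge0// ltW.
  have P6 : 0 <= b * (K * x) ^+ 2 by rewrite mulr_ge0 ?sqr_ge0// ltW.
  have P7 : 0 <= a * (x / K) ^+ 2 by rewrite mulr_ge0 ?sqr_ge0// ltW.
  have P8 : 0 <= b * (x / K) ^+ 2 by rewrite mulr_ge0 ?sqr_ge0// ltW.
  move: ((x / K) ^+ 2) ((K * x) ^+ 2) (x ^+ 2) (y ^+ 2) P1 P2 P3 P4 P5 P6 P7 P8.
  by move=> c d e i; clear; move=> *; apply/andP; split; lra.
have st n : step_grad w f n = Num.sqrt ((w n * decr f n ^+ 2 + w n.+1 * decr f n.+1 ^+ 2)
    / (2 * (w n + w n.+1))) by [].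
split.
  exists K => // n; have /andP[_ le] := H n.
  rewrite st (le_trans (ler_wsqrtr le))// sqrtr_sqr gtr0_norm//.
  exact: mulr_gt0.
exists (2 * K) => [|n]; first exact: mulr_gt0.
have /andP[le _] := H n.
rewrite -ler_pdivrMl ?mulr_gt0// mulrC st (le_trans _ (ler_wsqrtr le))//.
by rewrite sqrtr_sqr gtr0_norm// divr_gt0// mulr_gt0.
Qed.

Lemma decr_homo f m n : (forall n, 0 < decr f n) -> (m <= n)%N -> f n <= f m.
Proof.
move=> g0; elim: n => [|n IH]; first by rewrite leqn0 => /eqP ->.
rewrite leq_eqVlt => /predU1P[->//|/IH]; apply: le_trans.
by rewrite -subr_ge0 ltW// g0.
Qed.

Variables (N : nat) (V : choiceType) (E : rel V) (o : V).
Hypothesis N2 : (2 <= N)%N.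
Hypothesis hE : homogeneous_tree N E.

(** The root imposes a second bound on [eta], because the flux condition only
    concerns the vertices at positive distance. *)
Lemma admissible_scaling (p q r : R) w f : admissible r q w f ->
  exists2 eta : R, 0 < eta & forall A delta : R, 0 <= A -> 0 < delta ->
    (forall n, (A + delta * f n) `^ p * delta `^ (q - 1) <= eta * f n `^ r) ->
    nontrivial_positive_solution E (radial_weight E o w) p q
      (fun x => A + delta * f (depth E o x)).
Proof.
move=> [w0 f0 g0 [wS gS] flux].
have GS := step_grad_commensurate w0 g0 gS.
have G0 n : 0 < step_grad w f n.
  case: GS => _ [C C0 /(_ n)]; rewrite -ler_pdivrMl//; apply: lt_le_trans.
  by rewrite mulr_gt0 ?invr_gt0.
have fr0 n : 0 < f n `^ r by exact: powR_gt0.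
have [K K0 HK] : dominated
    (fun n => (w n + w n.+1) * f n.+1 `^ r * step_grad w f n `^ q)
    (fun n => w n.+1 * decr f n.+1 - w n * decr f n).
  apply: dominated_trans flux; apply: dominatedM.
  - by move=> n; rewrite mulr_gt0// addr_gt0.
  - by move=> n; exact: powR_gt0.
  - apply: dominatedM => //; first by move=> n; rewrite addr_gt0.
      by apply: dominatedD; [exact: dominated_le|exact: wS.1].
    exact: dominated_le.
  - exact: dominated_powR.
have c0 : 0 < f 0%N `^ r * (decr f 0 / Num.sqrt 2) `^ q.
  by rewrite mulr_gt0// powR_gt0// divr_gt0// sqrtr_gt0.
pose eta := Num.min K^-1 (decr f 0 / (f 0%N `^ r * (decr f 0 / Num.sqrt 2) `^ q)).
exists eta; first by rewrite lt_min invr_gt0 K0 divr_gt0.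
move=> A d A0 d0 H.
have u0 n : 0 < A + d * f n by rewrite ltr_wpDl// mulr_gt0.
have dE n m : (A + d * f n) - (A + d * f m) = d * (f n - f m) by ring.
have dq : d `^ q = d `^ (q - 1) * d.
  by rewrite -[X in _ * X]powRr1 ?(ltW d0)// -powRD ?subrK// (gt_eqF d0) implybT.
have Hd n (t : R) : 0 < t -> (A + d * f n) `^ p * (d * t) `^ q <=
    eta * (f n `^ r * t `^ q) * d.
  move=> t0; rewrite powRM ?(ltW d0) ?(ltW t0)// dq.
  rewrite [leLHS](_ : _ = (A + d * f n) `^ p * d `^ (q - 1) * t `^ q * d); last by ring.
  by rewrite ler_pM2r// mulrA ler_pM2r ?powR_gt0.
apply: (@radial_solution _ _ _ _ o N2 hE w (fun n => A + d * f n)) => //.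
- by move=> n; rewrite -subr_gt0 dE mulr_gt0// g0.
- rewrite dE -mulrA; apply: le_trans (Hd _ _ _) _.
    by rewrite divr_gt0// ?sqrtr_gt0//; exact: g0.
  rewrite mulrC ler_pM2l// -ler_pdivlMr//.
  by rewrite ge_min lexx orbT.
move=> k; have -> : step_grad w (fun n => A + d * f n) k = d * step_grad w f k.
  rewrite /step_grad !dE -[X in X * Num.sqrt _](gtr0_norm d0) -sqrtr_sqr.
  rewrite -sqrtrM ?sqr_ge0//; congr Num.sqrt.
  by field; rewrite gt_eqF// addr_gt0.
apply: le_trans (Hd _ _ (G0 k)) _; rewrite !dE.
have ww : 0 < w k + w k.+1 by rewrite addr_gt0.
rewrite ler_pdivlMr//.
have -> : w k.+1 * (d * (f k.+1 - f k.+2)) - w k * (d * (f k - f k.+1)) =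
  (w k.+1 * decr f k.+1 - w k * decr f k) * d by rewrite /decr; ring.
rewrite [leLHS]mulrAC ler_pM2r//.
have eK : eta <= K^-1 by rewrite ge_min lexx.
have P0 : 0 < f k.+1 `^ r * step_grad w f k `^ q by rewrite mulr_gt0// powR_gt0.
apply: (@le_trans _ _ (K^-1 * ((w k + w k.+1) * f k.+1 `^ r * step_grad w f k `^ q))).
  rewrite [leLHS](_ : _ = eta * ((w k + w k.+1) * f k.+1 `^ r * step_grad w f k `^ q)).
    by rewrite ler_pM2r// -mulrA mulr_gt0.
  by ring.
by rewrite ler_pdivrMl.
Qed.

Lemma radial_ball_commensurate w : (forall n, 0 < w n) ->
  commensurate (fun n => smeasure E (radial_weight E o w) (gball E o n))
             (fun n => \sum_(0 <= k < n.+1) w k).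
Proof.
move=> w0; have s0 n : 0 <= \sum_(0 <= k < n) w k by apply: sumr_ge0 => k _; exact: ltW.
split; last by apply: dominated_le => n; rewrite (radial_ball o N2 hE) lerDl.
exists 2 => // n; rewrite (radial_ball o N2 hE) mulr2n mulrDl mul1r lerD2l.
by rewrite big_nat_recr//= lerDl ltW.
Qed.

Lemma radial_ball_gt0 w n : (forall n, 0 < w n) ->
  0 < smeasure E (radial_weight E o w) (gball E o n).
Proof.
move=> w0; rewrite (radial_ball o N2 hE) big_nat_recl//.
by rewrite -addrA ltr_pwDl// addr_ge0// sumr_ge0// => k _; exact: ltW.
Qed.

Lemma monlog_volume w (a b : R) : 0 < a + 1 -> 0 <= b -> (forall n, 0 < w n) ->
  commensurate w (monlog a b) ->
  asymp (fun n => smeasure E (radial_weight E o w) (gball E o n))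
        (fun n => n%:R `^ (a + 1) * ln n%:R `^ b).
Proof.
move=> a0 b0 w0 wE; apply: asymp_monlog; first by move=> n; exact: radial_ball_gt0.
exact: commensurate_trans (radial_ball_commensurate w0) (sum_monlog a0 b0 w0 wE).
Qed.

Lemma commensurate_monlogS f a b : commensurate f (monlog a b) ->
  commensurate (fun n => f n.+1) f.
Proof.
move=> H; apply: (commensurate_trans _ (commensurate_sym H)).
apply: (commensurate_trans _ (monlogS_commensurate a b)).
by case: H => [[C C0 h] [D D0 k]]; split; [exists C|exists D].
Qed.

(** The exponents balance: [w f^r g^q] has the exponent
    [a + 1 - a * r - (a + 1) * q = -1] of [n] and the exponent
    [b + eps - b * r - b * q = eps - 1] of [ln n], which are those of the
    increments of the flux [(ln n)^eps]. *)
Lemma subcritical_profile (r q eps : R) : 1 - r < q -> q < 2 -> 0 < eps ->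
  exists w f, admissible r q w f /\
    commensurate w (monlog ((2 - q) / (r + q - 1) + 1) (1 / (r + q - 1) + eps)).
Proof.
move=> rq q2 e0; set s := r + q - 1; have s0 : 0 < s by rewrite /s; lra.
set a := (2 - q) / s; set b := 1 / s.
have a0 : 0 < a by rewrite divr_gt0// subr_gt0.
have b0 : 0 < b by rewrite divr_gt0.
have as_ : a * s = 2 - q by rewrite divfK// gt_eqF.
have bs : b * s = 1 by rewrite divfK// gt_eqF.
pose f := @monlog R (- a) (- b); pose h := @monlog R 0 eps.
have m0 := @monlog_gt0 R.
have gE : commensurate (decr f) (monlog (- a - 1) (- b)).
  have -> : - a - 1 = a - 1 - 2 * a by ring.
  have -> : - b = b - 2 * b by ring.
  exact: monlog_decrease (monlog_step_pow a0 (ltW b0)).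
have g0 n : 0 < decr f n.
  case: gE => _ [C C0 /(_ n)]; rewrite -ler_pdivrMl//; apply: lt_le_trans.
  by rewrite mulr_gt0 ?invr_gt0.
pose w n := h n / decr f n.
have w0 n : 0 < w n by rewrite divr_gt0// m0.
have wE : commensurate w (monlog (a + 1) (b + eps)).
  have -> : monlog (a + 1) (b + eps) = (fun n => h n * (monlog (- a - 1) (- b) n)^-1).
    by apply/funext => n; rewrite monlogV monlogM; congr (monlog _ _ n); ring.
  apply: commensurateM => //; try by move=> n; rewrite ?invr_gt0 ?m0.
    exact: commensurate_refl.
  exact: commensurateV.
exists w, f; split => //; split => //.
- by move=> n; exact: m0.
- by split; [exact: commensurate_monlogS wE|exact: commensurate_monlogS gE].
have -> : (fun n => w n.+1 * decr f n.+1 - w n * decr f n) = (fun n => h n.+1 - h n).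
  by apply/funext => n; rewrite /w !divfK// gt_eqF.
apply: dominated_trans (monlog_step_ln e0).2.
have -> : monlog (-1) (eps - 1) = (fun n => monlog (a + 1) (b + eps) n *
    monlog (- a) (- b) n `^ r * monlog (- a - 1) (- b) n `^ q).
  apply/funext => n; rewrite !monlog_powR !monlogM; congr (monlog _ _ n).
    by rewrite /s in as_; lra.
  by rewrite /s in bs; lra.
apply: dominatedM => //.
- by move=> n; rewrite mulr_gt0// powR_gt0// m0.
- by move=> n; exact: powR_gt0.
- apply: dominatedM => //.
  + by move=> n; rewrite powR_gt0// m0.
  + exact: wE.1.
  + apply: dominated_powR => //; first by move=> n; exact: m0.
    exact: monlogS_commensurate.
- exact: dominated_powR.
Qed.

(** With [h = 2 f 0 - f] as flux, which stays between two positive constants,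
    the flux increment is the decrement [g] itself, and [w g^q = h g^(q-1)] is
    dominated by [g] because [q - 1 >= 1] and [g] is bounded. *)
Lemma critical_profile (q eps : R) : 2 <= q -> 0 < eps ->
  exists w f, admissible 0 q w f /\ commensurate w (monlog 1 (1 + eps)).
Proof.
move=> q2 e0; pose f := @monlog R (- 0) (- eps).
have m0 := @monlog_gt0 R.
have gE : commensurate (decr f) (monlog (-1) (- eps - 1)).
  have := monlog_decrease (monlog_step_ln e0).
  have -> : eps - 1 - 2 * eps = - eps - 1 by ring.
  by rewrite mulr0 subr0.
have g0 n : 0 < decr f n.
  case: gE => _ [C C0 /(_ n)]; rewrite -ler_pdivrMl//; apply: lt_le_trans.
  by rewrite mulr_gt0 ?invr_gt0.
have f0 n : 0 < f n by exact: m0.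
have ff n : f n <= f 0%N by exact: decr_homo.
pose h n := 2 * f 0%N - f n.
have h0 n : 0 < h n.
  by rewrite /h mulr2n mulrDl mul1r -addrA ltr_pwDl ?subr_ge0//; exact: f0.
have hC : commensurate h (monlog 0 0).
  have -> : monlog 0 0 = (fun=> 1 : R).
    by apply/funext => n; rewrite /monlog !powRr0 mulr1.
  split.
    exists (2 * f 0%N) => [|n]; first exact: mulr_gt0 (f0 _).
    by rewrite mulr1 gerBl ltW.
  exists (f 0%N)^-1 => [|n]; first by rewrite invr_gt0; exact: f0.
  rewrite ler_pdivlMl; last exact: f0.
  by rewrite mulr1 /h mulr2n mulrDl mul1r -addrA lerDl subr_ge0.
pose w n := h n / decr f n.
have w0 n : 0 < w n by rewrite divr_gt0.
have wE : commensurate w (monlog 1 (1 + eps)).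
  have -> : monlog 1 (1 + eps) = (fun n => monlog 0 0 n * (monlog (-1) (- eps - 1) n)^-1).
    by apply/funext => n; rewrite monlogV monlogM; congr (monlog _ _ n); ring.
  apply: commensurateM => //; try by move=> n; rewrite ?invr_gt0.
  exact: commensurateV.
exists w, f; split => //; split => //.
  by split; [exact: commensurate_monlogS wE|exact: commensurate_monlogS gE].
have -> : (fun n => w n.+1 * decr f n.+1 - w n * decr f n) = decr f.
  by apply/funext => n; rewrite /w !divfK ?gt_eqF// /h /decr; ring.
apply: dominated_trans gE.2.
apply: (@dominated_trans _ _ (fun n => monlog 1 (1 + eps) n * monlog (-1) (- eps - 1) n `^ q)).
  under eq_fun do rewrite powRr0 mulr1.
  apply: dominatedM => //; first by move=> n; exact: powR_gt0.
    exact: wE.1.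
  exact: dominated_powR.
under eq_fun do rewrite monlog_powR monlogM.
by apply: monlog_le; nra.
Qed.

Lemma small_power (c s : R) : 0 < c -> 0 < s -> exists2 d : R, 0 < d <= 1 & d `^ s <= c.
Proof.
move=> c0 s0; exists (Num.min 1 (c `^ s^-1)).
  by rewrite lt_min ltr01 powR_gt0//= ge_min lexx.
have cs : (c `^ s^-1) `^ s = c by rewrite -powRrM mulVf ?gt_eqF// powRr1// ltW.
rewrite -[leRHS]cs; apply: ge0_ler_powR; rewrite ?nnegrE ?powR_ge0 ?(ltW s0)//.
  by rewrite le_min ler01 powR_ge0.
by rewrite ge_min lexx orbT.
Qed.

Lemma small_solution (p q : R) w f : 0 < p + q - 1 -> admissible p q w f ->
  exists u, nontrivial_positive_solution E (radial_weight E o w) p q u.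
Proof.
move=> s0 adm; have [eta e0 H] := admissible_scaling p adm.
have [d /andP[d0 _] de] := small_power e0 s0.
exists (fun x => 0 + d * f (depth E o x)); apply: H => // n.
case: adm => _ f0 _ _ _; rewrite add0r powRM ?(ltW (f0 n)) ?(ltW d0)// mulrAC.
by rewrite -powRD ?(gt_eqF d0) ?implybT// addrA ler_pM2r// powR_gt0.
Qed.

Lemma bounded_solution (p q : R) w f : 1 < q -> admissible 0 q w f ->
  exists u, nontrivial_positive_solution E (radial_weight E o w) p q u.
Proof.
move=> q1 adm; have [eta e0 H] := admissible_scaling p adm.
have [_ f0 g0 _ _] := adm.
(* as [1 + d * f n >= 1], the exponent [`|p|] covers both signs of [p] *)
pose M := (1 + f 0%N) `^ `|p|; have M0 : 0 < M by rewrite powR_gt0// addr_gt0.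
have q10 : 0 < q - 1 by rewrite subr_gt0.
have [d /andP[d0 d1] de] := small_power (divr_gt0 e0 M0) q10.
exists (fun x => 1 + d * f (depth E o x)); apply: H => // n.
rewrite powRr0 mulr1; apply: (@le_trans _ _ (M * (eta / M))); last first.
  by rewrite mulrCA divff ?gt_eqF// mulr1.
have df : 0 < d * f n by exact: mulr_gt0.
rewrite ler_pM ?powR_ge0//.
apply: (@le_trans _ _ ((1 + d * f n) `^ `|p|)).
  by rewrite ler_powR ?ler_norm// lerDl ltW.
rewrite ge0_ler_powR ?nnegrE ?addr_ge0 ?(ltW df) ?(ltW (f0 _))// lerD2l.
rewrite (@le_trans _ _ (f n))//; last exact: decr_homo.
by rewrite ler_piMl// ltW.
Qed.

Lemma large_solution (p : R) w f : p < 0 -> admissible 0 1 w f ->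
  exists u, nontrivial_positive_solution E (radial_weight E o w) p 1 u.
Proof.
move=> p0 adm; have [eta e0 H] := admissible_scaling p adm.
have [_ f0 _ _ _] := adm.
have [||d /andP[d0 d1] de] := @small_power eta (- p) => //; first by rewrite oppr_gt0.
have i0 : 0 < d^-1 by rewrite invr_gt0.
exists (fun x => d^-1 + 1 * f (depth E o x)); apply: H => //; first exact: ltW.
move=> n; rewrite subrr !powRr0 !mulr1 mul1r (le_trans _ de)//.
have x0 : 0 < d^-1 + f n by rewrite addr_gt0.
have -> : (d^-1 + f n) `^ p = ((d^-1 + f n) `^ (- p))^-1 by rewrite -powRN opprK.
have -> : d `^ (- p) = (d^-1 `^ (- p))^-1.
  by rewrite -(powR_inv1 (ltW d0)) -powRrM mulN1r [in RHS]powRN invrK.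
rewrite lef_pV2 ?posrE ?powR_gt0// ge0_ler_powR ?nnegrE ?(ltW i0) ?(ltW x0)//.
  by rewrite oppr_ge0 ltW.
by rewrite lerDl ltW.
Qed.

(** The decay rate [l / 2] lies strictly between 0 and [l]: [f] decreases while
    the flux still grows exponentially, hence proportionally to its own
    increments. *)
Lemma exponential_profile (l : R) : 0 < l ->
  exists f, admissible 0 1 (fun n => expR (l * n%:R)) f.
Proof.
move=> l0; pose t := l / 2; have t0 : 0 < t by rewrite divr_gt0.
pose c := 1 - expR (- t); have c0 : 0 < c by rewrite subr_gt0 expR_lt1 oppr_lt0.
pose f n := expR (- t * n%:R).
have gE n : decr f n = c * f n.
  by rewrite /decr /f -natr1 mulrDr expRD mulr1 /c; ring.
have e0 := @expR_gt0 R.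
exists f; split => [n|n|n||]; try exact: e0.
- by rewrite gE mulr_gt0// e0.
- split.
    have E1 n : expR (l * n.+1%:R) = expR l * expR (l * n%:R).
      by rewrite -expRD -natr1; congr expR; ring.
    split; [exists (expR l)|exists (expR l)^-1]; rewrite ?invr_gt0// => n; rewrite E1//.
    by rewrite mulKf// gt_eqF.
  have E1 n : decr f n.+1 = expR (- t) * decr f n.
    by rewrite !gE mulrCA /f -expRD -natr1; congr (_ * expR _); ring.
  split; [exists (expR (- t))|exists (expR (- t))^-1]; rewrite ?invr_gt0// => n; rewrite E1//.
  by rewrite mulKf// gt_eqF.
have wf n : expR (l * n%:R) * decr f n = c * expR (t * n%:R).
  by rewrite gE mulrCA /f -expRD; congr (_ * expR _); rewrite /t; field.
have r1 : 0 < expR t - 1 by rewrite subr_gt0 expR_gt1.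
exists (expR t - 1)^-1; first by rewrite invr_gt0.
move=> n; have g0 : 0 < decr f n by rewrite gE mulr_gt0// e0.
rewrite powRr0 mulr1 powRr1 ?(ltW g0)// !wf.
have -> : expR (t * n.+1%:R) = expR t * expR (t * n%:R).
  by rewrite -expRD -natr1; congr expR; ring.
by rewrite le_eqVlt (_ : _ == _)//; apply/eqP; field; rewrite gt_eqF.
Qed.

Lemma exponential_volume (l : R) : 0 < l ->
  asymp (fun n => smeasure E (radial_weight E o (fun n => expR (l * n%:R))) (gball E o n))
        (fun n => expR (l * n%:R)).
Proof.
move=> l0; pose w n := expR (l * n%:R); have w0 n : 0 < w n := expR_gt0 _.
have [[C C0 h1] [D D0 h2]] := radial_ball_commensurate w0.
have wE n : w n = expR l ^+ n by rewrite /w expRM_natr.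
have r1 : 0 < expR l - 1 by rewrite subr_gt0 expR_gt1.
exists (C * (expR l / (expR l - 1))), D; split => //.
  by rewrite mulr_gt0// divr_gt0// expR_gt0.
move=> n _; split.
  rewrite ler_pdivrMr ?expR_gt0//; apply: le_trans (h1 n) _; rewrite -mulrA ler_pM2l//.
  under eq_bigr do rewrite wE.
  rewrite -/(w n) wE mulrAC -exprS ler_pdivlMr// mulrC big_mkord -subrX1.
  by rewrite gerBl.
rewrite ler_pdivrMr ?radial_ball_gt0//; apply: le_trans (h2 n).
by rewrite big_nat_recr//= lerDr sumr_ge0// => k _; exact: ltW.
Qed.

End RadialProfiles.

(** * The homogeneous case p + q = 1 *)

Section HomogeneousCase.
Variables (R : realType) (N : nat) (V : choiceType) (E : rel V) (o : V).
Hypothesis N2 : (2 <= N)%N.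
Hypothesis hE : homogeneous_tree N E.

Lemma horofunction_example (p q T S : R) : p + q = 1 -> 1 < T -> 1 < S -> N.-1%:R <= S ->
  Num.sqrt (((T - 1) ^+ 2 + S * (1 - T^-1) ^+ 2) / (2 * (1 + S))) `^ q <=
    (S * (1 - T^-1) - (T - 1)) / (1 + S) ->
  exists (mu : V -> V -> R) (lambda : R),
    [/\ is_weight E mu, 0 < lambda,
        asymp (fun n => smeasure E mu (gball E o n)) (fun n => expR (lambda * n%:R))
      & exists u : V -> R, nontrivial_positive_solution E mu p q u].
Proof.
move=> pq T1 S1 NS le; have n0 := natN1_gt0 R N2.
have S0 : 0 < S by apply: lt_trans S1.
have T0 : 0 < T by apply: lt_trans T1.
pose l := ln (S / N.-1%:R).
have lS : N.-1%:R * expR l = S.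
  by rewrite lnK ?posrE ?divr_gt0// mulrC divfK// gt_eqF.
have l0 : 0 <= l by rewrite ln_ge0// ler_pdivlMr// mul1r.
exists (horo_weight E o l), (ln S); split.
- exact: (horo_is_weight o hE l).
- exact: ln_gt0.
- have := horo_ball o N2 hE l0; rewrite lS => /(_ S1).
  suff -> : (fun n => expR (ln S * n%:R)) = (fun n => S ^+ n) by [].
  by apply/funext => n; rewrite expRM_natr lnK.
- exists (fun x => expR (- ln T * height R E o x)).
  apply: (horo_solution o N2 hE) => //; first exact: ln_gt0.
  by rewrite lS lnK ?posrE.
Qed.

(** For [S = T^3] the squared gradient factor is at most [1/2], while the right-hand
    side is at least [1 - 2 / T]; since [q > 0], the left-hand side is at most
    [sqrt (1/2)^q < 1]. *)
Lemma homogeneous_qgt0 (p q : R) : p + q = 1 -> 0 < q ->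
  exists (mu : V -> V -> R) (lambda : R),
    [/\ is_weight E mu, 0 < lambda,
        asymp (fun n => smeasure E mu (gball E o n)) (fun n => expR (lambda * n%:R))
      & exists u : V -> R, nontrivial_positive_solution E mu p q u].
Proof.
move=> pq q0; pose c : R := Num.sqrt 2^-1 `^ q.
have c1 : 0 < 1 - c.
  have q1 : 1 `^ q = 1 :> R by rewrite powR1.
  rewrite subr_gt0 -[ltRHS]q1 gt0_ltr_powR ?nnegrE ?sqrtr_ge0//.
  by rewrite -[ltRHS]sqrtr1 ltr_sqrt//; lra.
have c20 : 0 < 2 / (1 - c) by rewrite divr_gt0.
(* [2 / (1 - c) <= T] means [c <= 1 - 2 / T] *)
pose T : R := 2 + N%:R + 2 / (1 - c).
have N0 : 0 <= N%:R :> R by [].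
have [T2 TN Tc] : [/\ 2 < T, N%:R <= T & 2 / (1 - c) <= T] by split; rewrite /T; lra.
have T0 : 0 < T by lra.
have Tc' : c <= 1 - 2 / T.
  by rewrite lerBrDr addrC -lerBrDr ler_pdivrMr// mulrC -ler_pdivrMr.
clearbody T.
have T3 : T <= T ^+ 3 by rewrite exprS ler_peMr ?(ltW T0)// expr2; nra.
have T30 : 0 < 1 + T ^+ 3 by lra.
apply: (@horofunction_example p q T (T ^+ 3)) => //; try lra.
  rewrite (le_trans _ T3)// (le_trans _ TN)// ler_nat; lia.
have -> : T ^+ 3 * (1 - T^-1) ^+ 2 = T * (T - 1) ^+ 2 by field; rewrite gt_eqF.
have -> : T ^+ 3 * (1 - T^-1) = T ^+ 3 - T ^+ 2 by field; rewrite gt_eqF.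
apply: (@le_trans _ _ c).
  rewrite /c ge0_ler_powR ?nnegrE ?sqrtr_ge0 ?(ltW q0)// ler_wsqrtr//.
  by rewrite ler_pdivrMr ?mulr_gt0// [leRHS]mulrA mulVf// mul1r; nra.
apply: (le_trans Tc'); rewrite ler_pdivlMr//.
rewrite -(ler_pM2l T0) mulrA mulrBr mulr1 mulrCA divff ?gt_eqF// mulr1.
have T40 : 0 <= T ^+ 2 * (T - 1) by rewrite mulr_ge0 ?sqr_ge0//; lra.
by move: T40; rewrite !exprS expr0; lra.
Qed.

(** For [T = t^2] and [S = t^3] the right-hand side is at least [1/2] for [t >= 8]
    and the gradient factor is at least [sqrt (t / 4)], whose negative power [q]
    is at most [1/2] for [t] large. *)
Lemma homogeneous_qlt0 (p q : R) : p + q = 1 -> q < 0 ->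
  exists (mu : V -> V -> R) (lambda : R),
    [/\ is_weight E mu, 0 < lambda,
        asymp (fun n => smeasure E mu (gball E o n)) (fun n => expR (lambda * n%:R))
      & exists u : V -> R, nontrivial_positive_solution E mu p q u].
Proof.
move=> pq q0; pose k : R := 2 `^ (- q^-1).
have k0 : 0 < k by exact: powR_gt0.
have kq : k `^ q = 2^-1.
  by rewrite /k -powRrM mulNr mulVf ?lt_eqF// powRN powRr1.
(* the last term makes the gradient factor exceed [k], where its power is [1/2] *)
pose t : R := 8 + N%:R + 4 * k ^+ 2.
have N0 : 0 <= N%:R :> R by [].
have k20 : 0 <= k ^+ 2 by exact: sqr_ge0.
have [t8 tN tk] : [/\ 8 <= t, N%:R <= t & k ^+ 2 <= t / 4] by split; rewrite /t; lra.
have t0 : 0 < t by lra.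
clearbody t k.
have t2 : t * 8 <= t ^+ 2 by rewrite expr2; nra.
have t3 : t ^+ 2 * 8 <= t ^+ 3 by rewrite (exprSr t 2); nra.
have t4 : t ^+ 3 * 8 <= t ^+ 4 by rewrite (exprSr t 3); nra.
have s0 : 0 < 1 + t ^+ 3 by lra.
apply: (@horofunction_example p q (t ^+ 2) (t ^+ 3)) => //; try lra.
  rewrite (@le_trans _ _ N%:R) ?ler_nat//; last by lra.
  by lia.
apply: (@le_trans _ _ 2^-1); last first.
  have -> : t ^+ 3 * (1 - (t ^+ 2)^-1) = t ^+ 3 - t by field; rewrite gt_eqF.
  by rewrite ler_pdivlMr// ler_pdivrMl//; lra.
set M := Num.sqrt _; have kM : k <= M.
  rewrite -(gtr0_norm k0) -sqrtr_sqr ler_wsqrtr// (le_trans tk)//.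
  rewrite ler_pdivlMr ?mulr_gt0// (@le_trans _ _ ((t ^+ 2 - 1) ^+ 2))//.
    have -> : (t ^+ 2 - 1) ^+ 2 = t ^+ 4 - 2 * t ^+ 2 + 1 by ring.
    have -> : t / 4 * (2 * (1 + t ^+ 3)) = (t + t ^+ 4) / 2 by field.
    lra.
  by rewrite lerDl mulr_ge0 ?sqr_ge0//; lra.
have M0 : 0 < M by exact: lt_le_trans kM.
rewrite -kq -(opprK q) powRN [leRHS]powRN lef_pV2 ?posrE ?powR_gt0//.
by rewrite ge0_ler_powR ?nnegrE ?(ltW k0) ?(ltW M0)// oppr_ge0 ltW.
Qed.

End HomogeneousCase.

(** * The theorem *)

Unset Implicit Arguments.

Theorem theorem1p5 (R : realType) (N : nat) (hN : (2 <= N)%N)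
    (V : choiceType) (E : rel V) (hT : homogeneous_tree N E)
    (o : V) (p q : R) :
  [/\ (* I *)
      0 <= p -> 1 - p < q -> q < 2 ->
      forall eps : R, 0 < eps ->
      exists mu : V -> V -> R,
        [/\ is_weight E mu,
            asymp (fun n => smeasure E mu (gball E o n))
                  (fun n => n%:R `^ ((2 * p + q) / (p + q - 1)) *
                            ln n%:R `^ (1 / (p + q - 1) + eps))
          & exists u : V -> R, nontrivial_positive_solution E mu p q u],
      (* II *)
      2 <= q ->
      forall eps : R, 0 < eps ->
      exists mu : V -> V -> R,
        [/\ is_weight E mu,
            asymp (fun n => smeasure E mu (gball E o n))
                  (fun n => n%:R ^+ 2 * ln n%:R `^ (1 + eps))
          & exists u : V -> R, nontrivial_positive_solution E mu p q u],
      (* III *)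
      p < 0 -> 1 < q -> q < 2 ->
      forall eps : R, 0 < eps ->
      exists mu : V -> V -> R,
        [/\ is_weight E mu,
            asymp (fun n => smeasure E mu (gball E o n))
                  (fun n => n%:R `^ (q / (q - 1)) *
                            ln n%:R `^ (1 / (q - 1) + eps))
          & exists u : V -> R, nontrivial_positive_solution E mu p q u],
      (* IV *)
      p < 0 -> q = 1 ->
      forall lambda : R, 0 < lambda ->
      exists mu : V -> V -> R,
        [/\ is_weight E mu,
            asymp (fun n => smeasure E mu (gball E o n))
                  (fun n => expR (lambda * n%:R))
          & exists u : V -> R, nontrivial_positive_solution E mu p q u]
    & (* V *)
      ([/\ p + q = 1, 0 <= p & 0 < q] \/ (p + q = 1 /\ q < 0)) ->
      exists (mu : V -> V -> R) (lambda : R),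
        [/\ is_weight E mu, 0 < lambda,
            asymp (fun n => smeasure E mu (gball E o n))
                  (fun n => expR (lambda * n%:R))
          & exists u : V -> R, nontrivial_positive_solution E mu p q u]].
Proof.
split.
- move=> p0 pq q2 eps e0; have s0 : 0 < p + q - 1 by lra.
  have [w [f [adm wE]]] := subcritical_profile pq q2 e0.
  exists (radial_weight E o w); have [w0 _ _ _ _] := adm; split.
  + exact: (radial_is_weight o hN hT).
  + have -> : (2 * p + q) / (p + q - 1) = (2 - q) / (p + q - 1) + 1 + 1.
      by field; rewrite gt_eqF.
    apply: (monlog_volume o hN hT) => //.
      by rewrite !addr_gt0// divr_gt0// subr_gt0.
    by rewrite addr_ge0 ?divr_ge0// ltW.
  + exact: (small_solution o hN hT s0 adm).
- move=> q2 eps e0; have [w [f [adm wE]]] := critical_profile q2 e0.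
  exists (radial_weight E o w); have [w0 _ _ _ _] := adm; split.
  + exact: (radial_is_weight o hN hT).
  + have -> : (fun n => n%:R ^+ 2 * ln n%:R `^ (1 + eps)) =
        (fun n => n%:R `^ (1 + 1) * ln n%:R `^ (1 + eps) : R).
      by apply/funext => n; rewrite -powR_mulrn.
    by apply: (monlog_volume o hN hT) => //; rewrite addr_ge0// ltW.
  + by apply: (bounded_solution o hN hT p _ adm); lra.
- move=> p0 q1 q2 eps e0; have rq : 1 - 0 < q by rewrite subr0.
  have [w [f [adm wE]]] := subcritical_profile rq q2 e0.
  rewrite add0r in wE; have s0 : 0 < q - 1 by lra.
  exists (radial_weight E o w); have [w0 _ _ _ _] := adm; split.
  + exact: (radial_is_weight o hN hT).
  + have -> : q / (q - 1) = (2 - q) / (q - 1) + 1 + 1.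
      by field; rewrite gt_eqF.
    apply: (monlog_volume o hN hT) => //.
      by rewrite !addr_gt0// divr_gt0// subr_gt0.
    by rewrite addr_ge0 ?divr_ge0// ltW.
  + exact: (bounded_solution o hN hT p q1 adm).
- move=> p0 -> l l0; have [f adm] := exponential_profile l0.
  exists (radial_weight E o (fun n => expR (l * n%:R))); split.
  + by apply: (radial_is_weight o hN hT) => // n; exact: expR_gt0.
  + exact: (exponential_volume o hN hT).
  + exact: (large_solution o hN hT p0 adm).
- case=> [[pq p0 q0]|[pq q0]]; first exact: (homogeneous_qgt0 o hN hT pq).
  exact: (homogeneous_qlt0 o hN hT pq).
Qed.
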